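(* Let $R=k[x_0,\ldots,x_n]$ be a polynomial ring over a field $k$ of any characteristic, let $s>3$ be an integer, and let $\mathcal F=\{F_1,\ldots,F_s\}$ be a set of $s$ forms in $R$ such that any four of them form a regular sequence. Let $I_3=\bigcap_{1\le i<j<h\le s}(F_i,F_j,F_h)$. For any positive integer $m$, write $m=6q+r$ where $q,r$ are integers and $0\le r\le5$. (1) Let $G:=F_1F_2\cdots F_s$, $G_i:=G/F_i$ for every $i=1,\ldots,s$ and $G_{ij}:=G/(F_iF_j)$ for all $i\ne j$ in $\{1,\ldots,s\}$. Then a minimal generating set of $I_3^{(m)}$ is $$\mathbf G_{3,(m)}=\{G^{a_1}G_i^{a_2}G_{ij}^{a_3} \mid 1\le i,j\le s,\ i\neq j,\ a_h\in\mathbb N_0\text{ and }3a_1+2a_2+a_3=m\},$$ and one has $$\mu(I_3^{(m)})=\begin{cases}\binom s2\left(\frac{m^2}{6}+\frac m3\right)+s\cdot\frac m6+1,&r=0\\ \binom s2\left(\frac{(m-1)^2}{6}+2\frac{m-1}{3}+1\right)+s\frac{m-1}{6},&r=1\\ \binom s2\left(\frac{(m-2)^2}{6}+m-1\right)+s\left(1+\frac{m-2}{6}\right),&r=2\\ \binom s2\left(\frac{(m-3)^2}{6}+4\frac m3-1\right)+s\frac{m-3}{6}+1,&r=3\\ \binom s2\left(\frac{(m-4)^2}{6}+5\frac{m-1}{3}-1\right)+s\left(1+\frac{m-4}{6}\right),&r=4\\ \binom s2\left(\frac{(m-5)^2}{6}+2m-4\right)+s\frac{m+1}{6},&r=5.\end{cases}$$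 (2) A minimal generating set of $I_3^{(m)}/I_3^m$ is (given by the images of) $$\mathbf G_{3,(m)}'=\{G^{a_1}G_i^{a_2}G_{ij}^{a_3}\in\mathbf G_{3,(m)} \mid a_1+a_2>0\},$$ and the $m$-th symbolic defect of $I_3$ is $$\mathrm{sdefect}(I_3,m)=\begin{cases}\binom s2\left(\frac{m^2}{6}+\frac m3-1\right)+s\cdot\frac m6+1,&r=0\\ \binom s2\left(\frac{(m-1)^2}{6}+2\frac{m-1}{3}\right)+s\frac{m-1}{6},&r=1\\ \binom s2\left(\frac{(m-2)^2}{6}+m-2\right)+s\left(1+\frac{m-2}{6}\right),&r=2\\ \binom s2\left(\frac{(m-3)^2}{6}+4\frac m3-2\right)+s\frac{m-3}{6}+1,&r=3\\ \binom s2\left(\frac{(m-4)^2}{6}+5\frac{m-1}{3}-2\right)+s\left(1+\frac{m-4}{6}\right),&r=4\\ \binom s2\left(\frac{(m-5)^2}{6}+2m-5\right)+s\frac{m+1}{6},&r=5.\end{cases}$$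
   Context: For a homogeneous ideal $I\subseteq R$ and $m\ge1$, $I^{(m)}=\bigcap_{P\in \mathrm{Ass}(R/I)}(I^mR_P\cap R)$. $\mu(U)$ is the minimal number of generators of a finitely generated graded $R$-module $U$, and $\mathrm{sdefect}(I,m):=\mu(I^{(m)}/I^m)$. $\mathbb N_0$ is the set of non-negative integers. The generating sets are sets of elements (repetitions are not counted). *)

(* Defs.v *)
From mathcomp Require Import all_boot all_order all_algebra.
From mathcomp Require Import classical_sets.
From mathcomp Require Import mpoly.

Set Implicit Arguments.
Unset Strict Implicit.
Unset Printing Implicit Defensive.

Import GRing.Theory.
Local Open Scope classical_set_scope.
Local Open Scope ring_scope.

Section Ideals.
Variable R : comNzRingType.
Implicit Types (X A B I P : set R).

Definition ideal_of X : set R :=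
  [set a | exists (n : nat) (c x : 'I_n -> R),
     (forall i, X (x i)) /\ a = \sum_(i < n) c i * x i].

Definition ideal_pow I (m : nat) : set R :=
  ideal_of [set a | exists2 x : 'I_m -> R,
                      (forall i, I (x i)) & a = \prod_(i < m) x i].

Definition is_ideal I : Prop :=
  [/\ I 0, (forall a b, I a -> I b -> I (a + b)) & (forall c a, I a -> I (c * a))].

Definition is_prime_ideal P : Prop :=
  [/\ is_ideal P, ~ P 1 & (forall a b, P (a * b) -> P a \/ P b)].

(* Ass(R/I): the annihilator of the class of f in R/I is {g | g f \in I}. *)
Definition associated_prime I P : Prop :=
  is_prime_ideal P /\ exists f : R, P = [set g | I (g * f)].

(* Each term is a nonzerodivisor modulo its predecessors, and the quotient
   by the whole sequence is nonzero. *)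
Definition regular_sequence (t : seq R) : Prop :=
  (forall i, (i < size t)%N ->
     forall a, ideal_of [set x | x \in take i t] (t`_i * a) ->
               ideal_of [set x | x \in take i t] a)
  /\ ~ ideal_of [set x | x \in t] 1.

(* The module A/B, for ideals B `<=` A, is represented by the pair (A, B):
   the images in A/B of the elements of X generate A/B when every element of A
   is congruent modulo B to a linear combination of elements of X.
   The ideal A itself is A/(0), i.e. B := [set 0]. *)
Definition generates_mod A B X : Prop :=
  X `<=` A /\ forall a, A a -> exists2 c, ideal_of X c & B (a - c).

(* Minimality is over subsets of X in R, so that it also says that the elements
   of X have pairwise distinct images in A/B. *)
Definition minimal_generating_set A B X : Prop :=
  generates_mod A B X /\ forall Y, Y `<` X -> ~ generates_mod A B Y.

(* mu(A/B) = N; as a relation, it also asserts that A/B is finitely generated. *)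
Definition mu_is A B (N : nat) : Prop :=
  (exists2 t : seq R, size t = N & generates_mod A B [set x | x \in t]) /\
  (forall t : seq R, generates_mod A B [set x | x \in t] -> (N <= size t)%N).

End Ideals.

Section SymbolicPowers.
Variable R : idomainType.
Implicit Types (I J P : set R).

(* R_P, as a subring of the fraction field of R. *)
Definition localization P : set {fraction R} :=
  [set x | exists a u : R, ~ P u /\ x = tofrac a / tofrac u].

(* J R_P \cap R, where J R_P is the ideal of R_P generated by J. *)
Definition ext_contr P J : set R :=
  [set f | exists (n : nat) (c : 'I_n -> {fraction R}) (x : 'I_n -> R),
     (forall i, localization P (c i) /\ J (x i)) /\
     tofrac f = \sum_(i < n) c i * tofrac (x i)].

Definition symbolic_power I (m : nat) : set R :=
  [set f | forall P, associated_prime I P -> ext_contr P (ideal_pow I m) f].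

Definition sdefect_is I (m N : nat) : Prop :=
  mu_is (symbolic_power I m) (ideal_pow I m) N.

End SymbolicPowers.

Section StarConfiguration.
Variables (k : fieldType) (n s : nat).
Variable F : 'I_s -> {mpoly k[n.+1]}.

Definition is_form (p : {mpoly k[n.+1]}) : Prop := exists d : nat, p \is d.-homog.

Definition star_ideal3 : set {mpoly k[n.+1]} :=
  [set f | forall i j h : 'I_s, (i < j)%N -> (j < h)%N ->
             ideal_of [set F i; F j; F h] f].

Definition Gall : {mpoly k[n.+1]} := \prod_(l < s) F l.
Definition Gdel1 (i : 'I_s) : {mpoly k[n.+1]} := \prod_(l < s | l != i) F l.
Definition Gdel2 (i j : 'I_s) : {mpoly k[n.+1]} :=
  \prod_(l < s | (l != i) && (l != j)) F l.

Definition star_gens (m : nat) : set {mpoly k[n.+1]} :=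
  [set g | exists (i j : 'I_s) (a1 a2 a3 : nat),
     [/\ i != j, (3 * a1 + 2 * a2 + a3)%N = m
       & g = Gall ^+ a1 * Gdel1 i ^+ a2 * Gdel2 i j ^+ a3]].

Definition star_gens' (m : nat) : set {mpoly k[n.+1]} :=
  [set g | exists (i j : 'I_s) (a1 a2 a3 : nat),
     [/\ i != j, (3 * a1 + 2 * a2 + a3)%N = m, (0 < a1 + a2)%N
       & g = Gall ^+ a1 * Gdel1 i ^+ a2 * Gdel2 i j ^+ a3]].

End StarConfiguration.

(* In the two formulas r is the residue of m modulo 6; the value for r > 5 is
   irrelevant. *)
Definition mu_formula (s m r : nat) : rat :=
  let S : rat := s%:R in
  let M : rat := m%:R in
  let C : rat := 'C(s, 2)%:R in
  match r with
  | 0 => C * (M ^+ 2 / 6 + M / 3) + S * (M / 6) + 1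
  | 1 => C * ((M - 1) ^+ 2 / 6 + 2 * ((M - 1) / 3) + 1) + S * ((M - 1) / 6)
  | 2 => C * ((M - 2) ^+ 2 / 6 + M - 1) + S * (1 + (M - 2) / 6)
  | 3 => C * ((M - 3) ^+ 2 / 6 + 4 * (M / 3) - 1) + S * ((M - 3) / 6) + 1
  | 4 => C * ((M - 4) ^+ 2 / 6 + 5 * ((M - 1) / 3) - 1) + S * (1 + (M - 4) / 6)
  | 5 => C * ((M - 5) ^+ 2 / 6 + 2 * M - 4) + S * ((M + 1) / 6)
  | _ => 0
  end.

Definition sdefect_formula (s m r : nat) : rat :=
  let S : rat := s%:R in
  let M : rat := m%:R in
  let C : rat := 'C(s, 2)%:R in
  match r with
  | 0 => C * (M ^+ 2 / 6 + M / 3 - 1) + S * (M / 6) + 1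
  | 1 => C * ((M - 1) ^+ 2 / 6 + 2 * ((M - 1) / 3)) + S * ((M - 1) / 6)
  | 2 => C * ((M - 2) ^+ 2 / 6 + M - 2) + S * (1 + (M - 2) / 6)
  | 3 => C * ((M - 3) ^+ 2 / 6 + 4 * (M / 3) - 2) + S * ((M - 3) / 6) + 1
  | 4 => C * ((M - 4) ^+ 2 / 6 + 5 * ((M - 1) / 3) - 2) + S * (1 + (M - 4) / 6)
  | 5 => C * ((M - 5) ^+ 2 / 6 + 2 * M - 5) + S * ((M + 1) / 6)
  | _ => 0
  end.

(* Main.v *)
Require Import Defs.
From mathcomp Require Import all_boot all_order all_algebra.
From mathcomp Require Import boolp classical_sets.
From mathcomp Require Import mpoly zify ring.

Set Implicit Arguments.
Unset Strict Implicit.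
Unset Printing Implicit Defensive.

Import Order.Theory GRing.Theory.
Local Open Scope classical_set_scope.
Local Open Scope ring_scope.

(** Write J_T = (F_l : l in T) for a set T of three indices, F^a for the monomial
    in the F_l with exponent vector [a], and a(T) for the sum of the exponents of
    [a] over T.

    The symbolic power is the intersection of the J_T^m ([symbolic_star3]).  A
    form F_l with l outside T is a non-zero-divisor modulo J_T, so that the
    associated primes of I_3 are those of the J_T, and at such a prime I_3 and
    J_T have the same localization.  One inclusion needs, for f outside J_T^m, an
    associated prime of J_T containing (J_T^m : f).  A regular sequence is
    quasi-regular ([quasi_regular]): the graded ring of the powers of J_T is a
    polynomial ring over R/J_T.  Hence (J_T^m : f) is contained in (J_T : c) for
    a leading coefficient c of f, and R is Noetherian ([noetherian]).

    The intersection is generated by monomials ([sym3_inter]): it is spanned by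
    the F^a with a(T) >= m for all T.  By induction, take f spanned by the F^a
    with a(T) >= d for all T and lying in all the J_T^(d+1).  Up to terms of the
    next level, f is a combination of the F^a with [mintype d a], where all
    exponents but those of at most two indices, forming a set B, equal the
    largest one; a(T) = d exactly when T contains B.  Reading f in the graded
    ring of each such J_T shows that the coefficient of F^a lies in J_T, and so
    in the intersection of the J_T with T containing B.  That intersection is
    generated by the F_l, l in B, and the products of all F_l outside a set of
    two indices containing B ([star_inter]); multiplying F^a by one of these
    elements increases every a(T) that equals d.

    The same reading of leading coefficients shows that a relation between the
    F^a with [mintype m a] has all its coefficients in some J_T, hence in the
    kernel of the evaluation at the origin.  This makes these generators minimal,
    and bounds the length of every generating list by comparing ranks of
    matrices over the field ([minimal_range], [mu_range]).  Modulo I_3^m the same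
    argument applies once the coefficients of an element of I_3^m are known:
    comparing degrees, the only minimal monomials that are [m]-fold products of
    generators of I_3 are the powers G_ij^m ([star3_pow_coef]).

    The exponent vectors are counted according to the set B: a pair of indices
    with two smaller exponents, one index with one, or none. *)

(** * Ideals given by generators *)

Section IdealTheory.
Variable R : comNzRingType.
Implicit Types (X A B I : set R).

Lemma ideal_of_is_ideal X : is_ideal (ideal_of X).
Proof.
split.
- by exists 0%N, (fun=> 0), (fun=> 0); split=> [[]|] //; rewrite big_ord0.
- move=> a b [n1 [c1 [x1 [Xx1 ->]]]] [n2 [c2 [x2 [Xx2 ->]]]].
  pose glue (f : 'I_n1 -> R) (g : 'I_n2 -> R) i :=
    match split i with inl j => f j | inr j => g j end.
  exists (n1 + n2)%N, (glue c1 c2), (glue x1 x2); split.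
    by move=> i; rewrite /glue; case: split.
  rewrite big_split_ord /=; congr (_ + _); apply: eq_bigr => i _.
    by rewrite /glue (unsplitK (inl i)).
  by rewrite /glue (unsplitK (inr i)).
- move=> c a [n [d [x [Xx ->]]]]; exists n, (fun i => c * d i), x; split=> //.
  by rewrite mulr_sumr; apply: eq_bigr => i _; rewrite mulrA.
Qed.

Lemma ideal_of_gen X : X `<=` ideal_of X.
Proof.
move=> x Xx; exists 1%N, (fun=> 1), (fun=> x); split=> //.
by rewrite big_ord1 mul1r.
Qed.

Lemma is_ideal_sum I (J : Type) (r : seq J) (P : pred J) (f : J -> R) :
  is_ideal I -> (forall i, P i -> I (f i)) -> I (\sum_(i <- r | P i) f i).
Proof. by case=> I0 ID _ If; elim/big_ind: _ => //; exact: ID. Qed.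

Lemma is_idealN I a : is_ideal I -> I a -> I (- a).
Proof. by case=> _ _ IM Ia; rewrite -mulN1r; exact: IM. Qed.

Lemma is_idealB I a b : is_ideal I -> I a -> I b -> I (a - b).
Proof. by move=> idI Ia /(is_idealN idI); case: idI => _ ID _; exact: ID. Qed.

Lemma is_idealMr I a c : is_ideal I -> I a -> I (a * c).
Proof. by case=> _ _ IM Ia; rewrite mulrC; exact: IM. Qed.

Lemma ideal_of_min X I : is_ideal I -> X `<=` I -> ideal_of X `<=` I.
Proof.
move=> idI XI f [n [c [x [Xx ->]]]]; apply: is_ideal_sum => // i _.
by case: idI => _ _ IM; exact: IM (XI _ (Xx i)).
Qed.

Lemma ideal_ofS X Y : X `<=` Y -> ideal_of X `<=` ideal_of Y.
Proof.
move=> XY; apply: ideal_of_min (ideal_of_is_ideal Y) _ => x /XY.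
exact: ideal_of_gen.
Qed.

Lemma colon_ideal I y : is_ideal I -> is_ideal [set x | I (x * y)].
Proof.
case=> I0 ID IM; split=> /=; first by rewrite mul0r.
  by move=> a b Ia Ib; rewrite mulrDl; exact: ID.
by move=> c a Ia; rewrite -mulrA; exact: IM.
Qed.

Lemma ideal_of_fin (T : finType) (P : pred T) (x : T -> R) f :
  ideal_of [set y | exists2 t, P t & y = x t] f ->
  exists c : T -> R, f = \sum_(t | P t) c t * x t.
Proof.
pose I : set R := [set g | exists c : T -> R, g = \sum_(t | P t) c t * x t].
apply: (@ideal_of_min _ I).
- split=> [|_ _ [c ->] [d ->]|e _ [c ->]].
  + by exists (fun=> 0); rewrite big1 // => t _; rewrite mul0r.
  + exists (fun t => c t + d t); rewrite -big_split /=.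
    by apply: eq_bigr => t _; rewrite mulrDl.
  + exists (fun t => e * c t); rewrite mulr_sumr.
    by apply: eq_bigr => t _; rewrite mulrA.
- move=> _ [t Pt ->]; exists (fun u => (u == t)%:R).
  rewrite (bigD1 t) //= eqxx mul1r big1 ?addr0 // => u /andP[_ /negbTE->].
  by rewrite mul0r.
Qed.

Lemma ideal_powS I m x y :
  I x -> ideal_pow I m y -> ideal_pow I m.+1 (x * y).
Proof.
move=> Ix; rewrite mulrC.
apply: (@ideal_of_min _ [set y | ideal_pow I m.+1 (y * x)]).
  exact: colon_ideal (ideal_of_is_ideal _).
move=> _ [z Iz ->]; apply: ideal_of_gen.
exists (fun i => if unlift ord0 i is Some j then z j else x).
  by move=> i; case: unliftP => [j _|_].
rewrite big_ord_recl unlift_none mulrC; congr (_ * _).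
by apply: eq_bigr => i _; rewrite liftK.
Qed.

Lemma ideal_pow_exp I m x : I x -> ideal_pow I m (x ^+ m).
Proof.
move=> Ix; apply: ideal_of_gen; exists (fun=> x) => //.
by rewrite prodr_const card_ord.
Qed.

End IdealTheory.

(** * Ideals generated by monomials in a finite family of elements *)

Section MonomialIdeals.
Variables (R : comNzRingType) (s : nat) (F : 'I_s -> R).
Implicit Types (U V W : 'X_{1..s} -> Prop) (a b : 'X_{1..s}) (T : {set 'I_s}).

Definition mon_ideal U : set R :=
  [set f | exists2 P : {mpoly R[s]},
     (forall a, a \in msupp P -> U a) & f = P.@[F]].

Lemma mmap1D a b : mmap1 F (a + b)%MM = mmap1 F a * mmap1 F b.
Proof. by rewrite commr_mmap1_M // => i x; apply: mulrC. Qed.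

Lemma mevalXE a : ('X_[a]).@[F] = mmap1 F a.
Proof. exact: mevalX. Qed.

Lemma meval_sum_supp (P : {mpoly R[s]}) :
  P.@[F] = \sum_(a <- msupp P) P@_a * mmap1 F a.
Proof. exact: mevalE. Qed.

Lemma mon_ideal_is_ideal U : is_ideal (mon_ideal U).
Proof.
split.
- by exists 0; [move=> a; rewrite msupp0|rewrite meval0].
- move=> _ _ [P UP ->] [Q UQ ->]; exists (P + Q); last by rewrite mevalD.
  by move=> a /msuppD_le; rewrite mem_cat => /orP[/UP|/UQ].
- move=> c _ [P UP ->]; exists (c *: P); last by rewrite mevalZ.
  by move=> a /msuppZ_le /UP.
Qed.

Lemma mon_ideal_gen U a : U a -> mon_ideal U (mmap1 F a).
Proof.
move=> Ua; exists 'X_[a]; last by rewrite mevalXE.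
by move=> b; rewrite msuppX inE => /eqP->.
Qed.

Lemma mon_ideal_min U (I : set R) : is_ideal I ->
  (forall a, U a -> I (mmap1 F a)) -> mon_ideal U `<=` I.
Proof.
move=> idI UI _ [P UP ->]; rewrite meval_sum_supp big_seq.
apply: is_ideal_sum => // a /UP /UI Ia.
by case: idI => _ _ IM; exact: IM.
Qed.

Lemma mon_idealS U V : (forall a, U a -> V a) -> mon_ideal U `<=` mon_ideal V.
Proof.
move=> UV; apply: mon_ideal_min (mon_ideal_is_ideal V) _ => a /UV.
exact: mon_ideal_gen.
Qed.

Lemma mon_idealM U V W x y : (forall a b, U a -> V b -> W (a + b)%MM) ->
  mon_ideal U x -> mon_ideal V y -> mon_ideal W (x * y).
Proof.
move=> UVW [P UP ->] [Q VQ ->]; exists (P * Q); last by rewrite mevalM.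
by move=> a /msuppM_le /allpairsP[[b c] /= [/UP Ub /VQ Vc ->]]; exact: UVW.
Qed.

Definition dg T a : nat := \sum_(l in T) a l.

Lemma dgD T a b : dg T (a + b)%MM = (dg T a + dg T b)%N.
Proof. by rewrite /dg -big_split; apply: eq_bigr => l _; rewrite mnmDE. Qed.

Lemma dgU T l : dg T U_(l)%MM = (l \in T).
Proof.
rewrite /dg; case: (boolP (l \in T)) => lT.
  rewrite (bigD1 l) //= mnm1E eqxx big1 ?addn0 // => i /andP[_].
  by rewrite mnm1E eq_sym => /negbTE->.
by rewrite big1 // => i iT; rewrite mnm1E; case: eqP => // li; rewrite li iT in lT.
Qed.

Lemma dg_gt0P T a : reflect (exists2 l, l \in T & (0 < a l)%N) (0 < dg T a)%N.
Proof.
rewrite lt0n sum_nat_eq0 negb_forall.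
apply: (iffP existsP) => [[l]|[l lT al]]; last by exists l; rewrite lT -lt0n.
by rewrite negb_imply -lt0n => /andP[]; exists l.
Qed.

Definition Jid T : set R := ideal_of [set x | exists2 l, l \in T & x = F l].

Lemma Jid_is_ideal T : is_ideal (Jid T).
Proof. exact: ideal_of_is_ideal. Qed.

(** The [d]-th power of [Jid T]: the other F_l may occur in the monomials, so
    that for varying [T] these powers are described by monomials in one common
    set of variables. *)
Definition Mpow T d : set R := mon_ideal (fun a => (d <= dg T a)%N).

Lemma mmap1_split l a : (0 < a l)%N ->
  mmap1 F a = F l * mmap1 F (a - U_(l))%MM.
Proof.
move=> al; rewrite -{1}(@submK _ U_(l)%MM a) ?lep1mP -?lt0n //.
by rewrite mmap1D mmap1U mulrC.
Qed.

Lemma Mpow1 T : Mpow T 1 = Jid T.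
Proof.
rewrite eqEsubset; split.
  apply: mon_ideal_min (ideal_of_is_ideal _) _ => a /dg_gt0P[l lT /mmap1_split->].
  by apply: is_idealMr (ideal_of_is_ideal _) _; apply: ideal_of_gen; exists l.
apply: ideal_of_min (mon_ideal_is_ideal _) _ => _ [l lT ->].
by rewrite -(mmap1U F l); apply: mon_ideal_gen; rewrite dgU lT.
Qed.

Lemma MpowM T d e x y : Mpow T d x -> Mpow T e y -> Mpow T (d + e) (x * y).
Proof. by apply: mon_idealM => a b da eb; rewrite dgD leq_add. Qed.

Lemma MpowS T d e : (e <= d)%N -> Mpow T d `<=` Mpow T e.
Proof. by move=> ed; apply: mon_idealS => a; exact: leq_trans. Qed.

Lemma Jid_Mpow T d x y : Jid T x -> Mpow T d y -> Mpow T d.+1 (x * y).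
Proof. by rewrite -Mpow1 -[d.+1]add1n; exact: MpowM. Qed.

Definition vars_in T a := forall l, l \notin T -> a l = 0%N.

Definition restr T a := [multinom if l \in T then a l else 0%N | l < s].

Lemma restrE T a l : restr T a l = if l \in T then a l else 0%N.
Proof. exact: mnmE. Qed.

Lemma restr_vars T a : vars_in T (restr T a).
Proof. by move=> l /negbTE lT; rewrite restrE lT. Qed.

Lemma mdeg_restr T a : mdeg (restr T a) = dg T a.
Proof. by rewrite mdegE /dg [RHS]big_mkcond; apply: eq_bigr => l _; rewrite restrE. Qed.

Lemma mmap1_restr T a :
  mmap1 F a = mmap1 F (restr (~: T) a) * mmap1 F (restr T a).
Proof.
rewrite -mmap1D; congr mmap1; apply/mnmP => l; rewrite mnmDE !restrE finset.in_setC.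
by case: (l \in T); rewrite ?addn0.
Qed.

Lemma restr_id T a : vars_in T a -> restr T a = a.
Proof.
by move=> Ta; apply/mnmP => l; rewrite restrE; case: ifPn => // /Ta.
Qed.

Lemma mdeg_vars T a : vars_in T a -> mdeg a = dg T a.
Proof. by move=> Ta; rewrite -mdeg_restr restr_id. Qed.

Lemma Mpow_vars T d f : Mpow T d f ->
  exists2 P : {mpoly R[s]}, (forall a, a \in msupp P -> vars_in T a /\ (d <= mdeg a)%N)
    & f = P.@[F].
Proof.
pose U a := vars_in T a /\ (d <= mdeg a)%N.
suff: Mpow T d `<=` mon_ideal U by move/(_ f).
apply: mon_ideal_min (mon_ideal_is_ideal _) _ => a da.
rewrite (mmap1_restr T); case: (mon_ideal_is_ideal U) => _ _; apply.
apply: mon_ideal_gen; split; first exact: restr_vars.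
by rewrite mdeg_restr.
Qed.

Lemma mon_ideal_vars T d :
  mon_ideal (fun a => vars_in T a /\ (d <= mdeg a)%N) `<=` Mpow T d.
Proof. by apply: mon_idealS => a [/mdeg_vars->]. Qed.

(** * Regular sequences are quasi-regular *)

Definition nzd_mod (I : set R) x := forall y, I (x * y) -> I y.

Lemma nzd_mod_prod (I : set R) (J : Type) (r : seq J) (P : pred J) (x : J -> R) :
  (forall j, P j -> nzd_mod I (x j)) -> nzd_mod I (\prod_(j <- r | P j) x j).
Proof.
move=> nzd; elim/big_ind: _ => // [y|x1 x2 nzd1 nzd2 y]; first by rewrite mul1r.
by rewrite -mulrA => /nzd1/nzd2.
Qed.

Lemma nzd_mod_exp (I : set R) x n : nzd_mod I x -> nzd_mod I (x ^+ n).
Proof.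
by move=> nzd; elim: n => [|n IHn] y; rewrite ?mul1r // exprS -mulrA => /nzd/IHn.
Qed.

Lemma mcoeff_eq0P (P : {mpoly R[s]}) U a :
  (forall b, b \in msupp P -> U b) -> ~ U a -> P@_a = 0.
Proof. by move=> UP nUa; apply: memN_msupp_eq0; apply/negP => /UP. Qed.

Lemma mcoeff_sumX (r : seq 'X_{1..s}) (Q : pred 'X_{1..s}) (c : 'X_{1..s} -> R)
    (g : 'X_{1..s} -> 'X_{1..s}) b :
  (\sum_(a <- r | Q a) c a *: 'X_[g a])@_b
    = \sum_(a <- r | Q a && (g a == b)) c a.
Proof.
rewrite raddf_sum [RHS]big_mkcondr; apply: eq_bigr => a _ /=.
by rewrite mcoeffZ mcoeffX; case: eqP => _; rewrite ?mulr1 ?mulr0.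
Qed.

Lemma msupp_sumX_sub (r : seq 'X_{1..s}) (Q : pred 'X_{1..s})
    (c : 'X_{1..s} -> R) (g : 'X_{1..s} -> 'X_{1..s}) b :
  b \in msupp (\sum_(a <- r | Q a) c a *: 'X_[g a]) ->
  exists a, [/\ a \in r, Q a & g a = b].
Proof.
move=> /msupp_sum_le /flatten_mapP[a].
rewrite mem_filter => /andP[Qa ar] /msuppZ_le; rewrite msuppX inE => /eqP->.
by exists a.
Qed.

Lemma split_var (P : {mpoly R[s]}) l :
  exists P0 P1 : {mpoly R[s]},
  [/\ P = P0 + 'X_l * P1,
      forall a, a \in msupp P0 -> a \in msupp P /\ a l = 0%N,
      forall a, a \in msupp P1 -> (a + U_(l))%MM \in msupp P,
      forall a, a l = 0%N -> P0@_a = P@_a &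
      forall a, P1@_a = P@_(a + U_(l))].
Proof.
pose P0 := \sum_(a <- msupp P | a l == 0%N) P@_a *: 'X_[a].
pose P1 := \sum_(a <- msupp P | a l != 0%N) P@_a *: 'X_[a - U_(l)].
have subE a : a l != 0%N -> (a - U_(l) + U_(l) = a)%MM.
  by move=> al; rewrite submK // lep1mP.
have P1E a : P1@_a = P@_(a + U_(l)).
  have uq : uniq (msupp P) := msupp_uniq P.
  have ab b : b l != 0%N -> (b - U_(l) == a)%MM = (b == a + U_(l))%MM.
    by move=> bl; rewrite -(eqm_add2r U_(l)%MM) subE.
  rewrite mcoeff_sumX; case: (boolP ((a + U_(l))%MM \in msupp P)) => aP.
    rewrite -big_filter (bigD1_seq (a + U_(l))%MM) ?filter_uniq //=; last first.
      by rewrite mem_filter aP addmK eqxx mnmDE mnm1E eqxx addn1.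
    rewrite big_seq_cond big1 ?addr0 // => b; rewrite mem_filter.
    by case/andP=> /andP[/andP[bl]]; rewrite ab // => ->.
  rewrite (memN_msupp_eq0 aP) big_seq_cond big1 // => b /andP[bP /andP[bl]].
  by rewrite ab // => /eqP ba; rewrite ba (negbTE aP) in bP.
exists P0, P1; split=> //.
- rewrite {1}[P]mpolyE (bigID (fun a : 'X_{1..s} => a l == 0%N)) /=.
  congr (_ + _); rewrite mulr_sumr; apply: eq_bigr => a al.
  by rewrite -scalerAr -mpolyXD addmC subE.
- by move=> a /msupp_sumX_sub[b [bP /eqP bl <-]].
- by move=> a /msupp_sumX_sub[b [bP bl <-]]; rewrite subE.
- move=> a al; rewrite mcoeff_sumX.
  case: (boolP (a \in msupp P)) => aP.
    rewrite -big_filter (bigD1_seq a) ?filter_uniq ?msupp_uniq //=; last first.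
      by rewrite mem_filter aP al !eqxx.
    rewrite big_seq_cond big1 ?addr0 // => b; rewrite mem_filter.
    by case/andP=> /andP[/andP[_ ->]].
  rewrite (memN_msupp_eq0 aP) big_seq_cond big1 // => b /andP[bP /andP[_]].
  by move=> /eqP ba; rewrite ba (negbTE aP) in bP.
Qed.

Definition quasi_reg_deg T d := forall P : {mpoly R[s]},
  (forall a, a \in msupp P -> vars_in T a /\ (d <= mdeg a)%N) ->
  P.@[F] = 0 -> forall a, mdeg a = d -> Jid T P@_a.

Definition quasi_reg T := forall d, quasi_reg_deg T d.

Lemma Mpow_succ T d (P : {mpoly R[s]}) :
  (forall a, a \in msupp P -> (d <= dg T a)%N) ->
  (forall a, a \in msupp P -> dg T a = d -> Jid T P@_a) -> Mpow T d.+1 P.@[F].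
Proof.
move=> dP JP; rewrite meval_sum_supp big_seq.
apply: is_ideal_sum (mon_ideal_is_ideal _) _ => a aP.
have := dP a aP; rewrite leq_eqVlt => /predU1P[da|da].
  by apply: Jid_Mpow; [exact: JP|apply: mon_ideal_gen; rewrite da].
by case: (mon_ideal_is_ideal (fun a => (d < dg T a)%N)) => _ _; apply; exact: mon_ideal_gen.
Qed.

Lemma Mpow_nzd T x d : quasi_reg T -> nzd_mod (Jid T) x -> nzd_mod (Mpow T d) x.
Proof.
move=> qrT nzdx; elim: d => [|d IHd] y.
  move=> _; exists y%:MP; last by rewrite mevalC.
  by move=> a _.
move=> xy; have /Mpow_vars[Q QT yQ] := IHd y (MpowS (leqnSn d) xy).
have [Q' Q'T xyQ'] := Mpow_vars xy.
rewrite yQ; apply: Mpow_succ => [a /QT[/mdeg_vars<-] //|a aQ da].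
have [Ta _] := QT a aQ; apply: nzdx.
have Q'a : Q'@_a = 0.
  by apply: (mcoeff_eq0P Q'T) => -[_]; rewrite (mdeg_vars Ta) da ltnn.
have -> : x * Q@_a = (x *: Q - Q')@_a by rewrite mcoeffB mcoeffZ Q'a subr0.
apply: (qrT d); last by rewrite (mdeg_vars Ta).
  move=> b /msuppB_le; rewrite mem_cat => /orP[/msuppZ_le/QT //|/Q'T[Tb db]].
  by split=> //; exact: ltnW.
by rewrite mevalB mevalZ -yQ -xyQ' subrr.
Qed.

(** Induction on the number of elements and on the degree: if
    [P0 + F_l P1] vanishes with ['X_l] absent from [P0], then [F_l P1] lies in
    the [d]-th power of the ideal of the other elements, hence so does [P1], and
    both [P1] and [P0] can be corrected by a polynomial in the other variables
    so as to vanish on their own. *)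
Lemma quasi_regular T :
  (forall T' l, T' \subset T -> l \in T -> l \notin T' -> nzd_mod (Jid T') (F l)) ->
  quasi_reg T.
Proof.
have [k] := ubnP #|T|; elim: k T => // k IHk T; rewrite ltnS => Tk regT.
have [-> d P TP P0 a _|[l lT]] := set_0Vmem T.
  have P_C : P = (P@_0)%:MP.
    apply/mpolyP => b; rewrite mcoeffC; case: eqP => [->|b0]; rewrite ?mulr1 //.
    rewrite mulr0; apply: (mcoeff_eq0P TP) => -[Tb _]; case: b0.
    by apply/mnmP => l; rewrite mnm0E Tb // inE.
  move: P0; rewrite P_C mevalC => ->; rewrite mcoeffC mul0r.
  by case: (Jid_is_ideal (@finset.set0 _)).
pose T' := (T :\ l)%SET.
have T'T : T' \subset T by exact: subD1set.
have lT' : l \notin T' by rewrite !inE eqxx.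
have qrT' : quasi_reg T'.
  apply: IHk => [|T'' j sT'' jT' jT''].
    by rewrite (leq_trans _ Tk) // [in X in (_ <= X)%N](cardsD1 l) lT.
  apply: (regT T'' j (fintype.subset_trans sT'' T'T)) => //; exact: (fintype.subsetP T'T).
have JT'T : Jid T' `<=` Jid T.
  apply: ideal_ofS => _ [j jT' ->]; exists j => //; exact: (fintype.subsetP T'T).
have nzdl : nzd_mod (Jid T') (F l) by exact: regT.
have varsT' a : vars_in T a -> a l = 0%N -> vars_in T' a.
  by move=> Ta al j; rewrite !inE negb_and negbK => /orP[/eqP->|/Ta].
have varsT a : vars_in T' a -> vars_in T a.
  by move=> T'a j jT; apply: T'a; apply: contra jT; exact: (fintype.subsetP T'T).
suff step d : (forall e, d = e.+1 -> quasi_reg_deg T e) -> quasi_reg_deg T d.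
  by move=> e; elim: e => [|e IHe]; apply: step => // e2 [<-].
move=> IHd P TP P0 a da.
have [Q0 [P1 [defP Q0P P1P Q0E P1E]]] := split_var P l.
have Q0T' b : b \in msupp Q0 -> vars_in T' b /\ (d <= mdeg b)%N.
  by case/Q0P=> /TP[Tb db] bl; split=> //; exact: varsT'.
have evP : Q0.@[F] + F l * P1.@[F] = 0.
  by rewrite -[RHS]P0 [in RHS]defP mevalD mevalM mevalXE mmap1U.
have : Mpow T' d P1.@[F].
  apply: (Mpow_nzd qrT' nzdl).
  have -> : F l * P1.@[F] = - Q0.@[F].
    by apply/eqP; rewrite -addr_eq0 addrC evP.
  apply: is_idealN (mon_ideal_is_ideal _) _; apply: mon_ideal_vars.
  by exists Q0.
case/Mpow_vars=> E ET' evE; have [al|al] := eqVneq (a l) 0%N.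
  have Ja : Jid T' (Q0 + F l *: E)@_a.
    apply: (qrT' d) => // [b|].
      by move/msuppD_le; rewrite mem_cat => /orP[/Q0T'|/msuppZ_le/ET'].
    by rewrite mevalD mevalZ -evE.
  rewrite -(Q0E _ al) -[Q0@_a](addrK (F l * E@_a)).
  apply: is_idealB (ideal_of_is_ideal _) _ _.
    by apply: JT'T; rewrite mcoeffD mcoeffZ in Ja.
  by apply: is_idealMr (ideal_of_is_ideal _) _; apply: ideal_of_gen; exists l.
have defa : (a - U_(l) + U_(l) = a)%MM by rewrite submK // lep1mP.
have mdega : mdeg a = (mdeg (a - U_(l))%MM).+1 by rewrite -{1}defa mdegD mdeg1 addn1.
have {IHd}IHd := IHd (mdeg (a - U_(l))%MM) (etrans (esym da) mdega).
have -> : P@_a = (P1 - E)@_(a - U_(l)).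
  rewrite mcoeffB P1E defa (mcoeff_eq0P ET') ?subr0 // => -[_].
  by rewrite -da mdega ltnn.
apply: IHd => // [b|]; last by rewrite mevalB evE subrr.
move/msuppB_le; rewrite mem_cat => /orP[/P1P/TP[Tb db]|/ET'[T'b db]].
  split=> [j jT|]; first by have := Tb j jT; rewrite mnmDE => /eqP; rewrite addn_eq0 => /andP[/eqP].
  by move: db; rewrite -da mdega mdegD mdeg1 addn1.
by split; [exact: varsT|apply: leq_trans db; rewrite -da mdega].
Qed.

End MonomialIdeals.

Section StarPowers.
Variables (R : comNzRingType) (s : nat) (F : 'I_s -> R).
Implicit Types (a b : 'X_{1..s}) (T : {set 'I_s}).
Hypothesis regF : forall T l, (#|T| <= 3)%N -> l \notin T -> nzd_mod (Jid F T) (F l).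

Lemma quasi_reg3 T : (#|T| <= 3)%N -> quasi_reg F T.
Proof.
move=> T3; apply: quasi_regular => T' l sT' _ lT'; apply: regF => //.
exact: leq_trans (subset_leq_card sT') T3.
Qed.

(** If no other monomial of [P] restricts to the same monomial in the F_l,
    l \in T, then [a] alone contributes to its component in the graded ring of
    the powers of [Jid T], where the coefficient is [P@_a] times a
    non-zero-divisor. *)
Lemma leading_coef_in T d (P : {mpoly R[s]}) a : (#|T| <= 3)%N ->
  (forall b, b \in msupp P -> (d <= dg T b)%N) -> Mpow F T d.+1 P.@[F] ->
  dg T a = d -> (forall b, b \in msupp P -> restr T b = restr T a -> b = a) ->
  Jid F T P@_a.
Proof.
move=> T3 dP /Mpow_vars[Q QT PQ] da uniqa.
case: (boolP (a \in msupp P)) => [aP|/memN_msupp_eq0->]; last first.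
  by case: (Jid_is_ideal F T).
pose c b := P@_b * mmap1 F (restr (~: T) b).
pose P' := \sum_(b <- msupp P) c b *: 'X_[restr T b].
have P'P : P'.@[F] = P.@[F].
  rewrite [RHS]meval_sum_supp raddf_sum /=; apply: eq_bigr => b _.
  by rewrite mevalZ mevalXE (mmap1_restr _ T b) mulrA.
have nzda : nzd_mod (Jid F T) (mmap1 F (restr (~: T) a)).
  apply: nzd_mod_prod => l _; rewrite restrE finset.in_setC.
  case: ifPn => [lT|_ y]; first by apply: nzd_mod_exp; exact: regF.
  by rewrite expr0 mul1r.
apply: nzda; rewrite mulrC.
have -> : P@_a * mmap1 F (restr (~: T) a) = (P' - Q)@_(restr T a).
  rewrite mcoeffB (mcoeff_eq0P QT) ?subr0; last first.
    by move=> [_]; rewrite mdeg_restr da ltnn.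
  rewrite mcoeff_sumX /= -big_filter.
  rewrite (bigD1_seq a) ?filter_uniq ?msupp_uniq //=; last first.
    by rewrite mem_filter aP eqxx.
  rewrite big_seq_cond big1 ?addr0 // => b /andP[].
  by rewrite mem_filter => /andP[/eqP ba bP] /eqP[]; exact: uniqa.
apply: (quasi_reg3 T3 (d := d)); last by rewrite mdeg_restr.
  move=> b /msuppB_le; rewrite mem_cat => /orP[|/QT[Tb db]]; last by split; last exact: ltnW.
  case/msupp_sumX_sub=> b' [b'P _ <-]; split; first exact: restr_vars.
  by rewrite mdeg_restr; exact: dP.
by rewrite mevalB P'P PQ subrr.
Qed.

(** * Intersections of ideals generated by three of the elements *)

(** The generators of the intersection of the [Jid T] over the three-element sets
    [T] between [B] and [V]. *)
Definition star_gen (B V : {set 'I_s}) (x : R) : Prop :=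
  (exists2 l, l \in B & x = F l) \/
  exists E : {set 'I_s}, [/\ B \subset E, E \subset V, #|E| = 2%N
                           & x = \prod_(l in V :\: E) F l].

(** Induction on [V]: write [f] as a combination of the generators for [V :\ v].
    Modulo [Jid (v |: E)] only the product over the complement of [E] survives,
    and it is a non-zero-divisor there, so its coefficient lies in that ideal;
    multiplying the product by any generator of that ideal gives a generator
    for [V]. *)
Lemma star_inter (B V : {set 'I_s}) f : (#|B| <= 2)%N -> B \subset V -> (1 < #|V|)%N ->
  (forall T : {set 'I_s}, B \subset T -> T \subset V -> #|T| = 3%N -> Jid F T f) ->
  ideal_of (star_gen B V) f.
Proof.
move=> B2; have [k] := ubnP #|V|; elim: k V => // k IHk V; rewrite ltnS => Vk BV.
rewrite leq_eqVlt => /predU1P[V2 _|V3 fJ].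
  have [_ _] := ideal_of_is_ideal (star_gen B V).
  move=> /(_ f 1); rewrite mulr1; apply; apply: ideal_of_gen; right.
  by exists V; split=> //; rewrite finset.setDv big_set0.
have [v vV vB] : exists2 v, v \in V & v \notin B.
  have : ~~ (V \subset B).
    by apply: contraL V3 => /subset_leq_card VB; rewrite -leqNgt (leq_trans VB).
  by case/subsetPn=> v; exists v.
pose V' := (V :\ v)%SET.
have cV : #|V| = #|V'|.+1 by rewrite (cardsD1 v) vV.
have V'V : V' \subset V by exact: finset.subD1set.
have vV' : v \notin V' by rewrite !inE eqxx.
have BV' : B \subset V' by rewrite finset.subsetD1 BV.
have : ideal_of (star_gen B V') f.
  apply: IHk => // [||T BT TV']; first by rewrite -cV.
    by rewrite cV in V3.
  by apply: fJ BT _; exact: fintype.subset_trans TV' V'V.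
pose P (t : 'I_s + {set 'I_s}) := match t with
  | inl l => l \in B
  | inr E => [&& B \subset E, E \subset V' & #|E| == 2%N] end.
pose x (t : 'I_s + {set 'I_s}) := match t with
  | inl l => F l | inr E => \prod_(l in V' :\: E) F l end.
have genP : star_gen B V' `<=` [set y | exists2 t, P t & y = x t].
  move=> _ [[l lB ->]|[E [BE EV' E2 ->]]]; first by exists (inl l).
  by exists (inr E) => //=; rewrite BE EV' E2.
move=> /(ideal_ofS genP)/ideal_of_fin[c cf].
rewrite cf; apply: is_ideal_sum; first exact: ideal_of_is_ideal.
have idZ := ideal_of_is_ideal (star_gen B V); have [_ _ ZM] := idZ.
move=> [l lB|E PE] /=.
  by apply: ZM; apply: ideal_of_gen; left; exists l.
have /and3P[BE EV' /eqP E2] := PE.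
pose T := (v |: E)%SET.
have vE : v \notin E by apply: contra vV'; exact: (fintype.subsetP EV').
have T3 : #|T| = 3%N by rewrite cardsU1 vE E2.
have : Jid F T (c (inr E)).
  have prod_nzd : nzd_mod (Jid F T) (x (inr E)).
    apply: nzd_mod_prod => l; rewrite !inE => /and3P[lE lv _]; apply: regF.
      by rewrite T3.
    by rewrite !inE negb_or lv.
  apply: prod_nzd; rewrite mulrC.
  have -> : c (inr E) * x (inr E) =
      f - \sum_(t | P t && (t != inr E)) c t * x t.
    by rewrite cf (bigD1 (inr E)) //= addrK.
  apply: is_idealB (Jid_is_ideal F T) _ _.
    apply: fJ => //; first by rewrite (fintype.subset_trans BE) ?finset.subsetUr.
    by rewrite finset.subUset finset.sub1set vV (fintype.subset_trans EV').
  apply: is_ideal_sum (Jid_is_ideal F T) _ => -[l|E'] /andP[Pt tE].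
    case: (Jid_is_ideal F T) => _ _; apply; apply: ideal_of_gen.
    by exists l => //; rewrite !inE (fintype.subsetP BE) ?orbT.
  have /and3P[_ E'V' /eqP E'2] := Pt.
  have [h hE hE'] : exists2 h, h \in E & h \notin E'.
    apply/subsetPn; apply: contra tE => EE'.
    by rewrite eq_sym (inj_eq (@inr_inj _ _)) eqEcard EE' E2 E'2.
  case: (Jid_is_ideal F T) => _ _; apply.
  rewrite /x (bigD1 h) /=; last by rewrite !inE hE' /= -in_setD1 (fintype.subsetP EV').
  apply: is_idealMr (Jid_is_ideal F T) _; apply: ideal_of_gen.
  by exists h => //; rewrite !inE hE orbT.
apply: (@ideal_of_min _ _ [set y | ideal_of (star_gen B V) (y * x (inr E))]).
  exact: colon_ideal.
move=> _ [e + ->] /=; rewrite !inE => eT.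
have [eB|eB] := boolP (e \in B).
  by apply: is_idealMr idZ _; apply: ideal_of_gen; left; exists e.
pose E1 := (T :\ e)%SET.
have defE1 : (V :\: E1 = e |: (V' :\: E))%SET.
  apply/setP => l; rewrite !inE; have [->|le] := eqVneq l e.
    rewrite /= ?orbT; case/orP: eT => [/eqP->//|eE].
    by rewrite (fintype.subsetP V'V) // (fintype.subsetP EV').
  by rewrite /=; case: (l == v); rewrite ?andbF.
apply: ideal_of_gen; right; exists E1; split.
- by rewrite finset.subsetD1 (fintype.subset_trans BE) ?finset.subsetUr.
- rewrite (fintype.subset_trans (finset.subD1set _ _)) // finset.subUset finset.sub1set vV.
  exact: fintype.subset_trans V'V.
- have : e \in T by rewrite !inE.
  by move=> eT'; apply/eqP; rewrite -eqSS -add1n -T3 (cardsD1 e T) eT'.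
- rewrite defE1 big_setU1 //= !inE negb_and negbK.
  by case/orP: eT => [/eqP->|->//]; rewrite eqxx orbT.
Qed.

End StarPowers.

(** * The monomials generating the symbolic powers *)

Section StarMonomials.
Variable s : nat.
Implicit Types (a : 'X_{1..s}) (T B : {set 'I_s}).

Definition sym3 d a := [forall T : {set 'I_s}, (#|T| == 3%N) ==> (d <= dg T a)%N].

Lemma sym3P d a :
  reflect (forall T, #|T| = 3%N -> (d <= dg T a)%N) (sym3 d a).
Proof.
apply: (iffP forallP) => h T; first by move=> T3; have /implyP := h T; apply; apply/eqP.
by apply/implyP => /eqP /h.
Qed.

(** The exponent vectors of the elements G^a1 * G_i^a2 * G_ij^a3, for which
    [a i = a1], [a j = a1 + a2] and the common value [b] is [a1 + a2 + a3]; here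
    [i] and [j] may be exchanged. *)
Definition mintype_at d a (i j : 'I_s) (b : nat) : Prop :=
  [/\ i != j, (a i <= b)%N, (a j <= b)%N, (a i + a j + b)%N = d &
      forall l, l != i -> l != j -> a l = b].

Definition mintype d a : Prop := exists i j (b : nat), mintype_at d a i j b.

(** With [b] the largest exponent, the three smallest exponents of [a] are those
    of any three indices among which are all those of exponent less than [b]. *)
Lemma mintype_small d a : mintype d a -> exists b B,
  [/\ (#|B| <= 2)%N, forall l, l \notin B -> a l = b, forall l, l \in B -> (a l < b)%N &
      forall T, #|T| = 3%N -> (d <= dg T a)%N /\ (dg T a = d <-> B \subset T)].
Proof.
case=> i [j [b [ij aib ajb defd aE]]].
pose B := [set l : 'I_s | (a l < b)%N]%SET; exists b, B.
have a_le l : (a l <= b)%N.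
  by have [->//|li] := eqVneq l i; have [->//|lj] := eqVneq l j; rewrite aE.
have defsum T : #|T| = 3%N -> (dg T a + \sum_(l in T) (b - a l) = 3 * b)%N.
  move=> T3; rewrite -T3 -sum_nat_const -big_split /=.
  by apply: eq_bigr => l _; rewrite subnKC.
have sum_all : (\sum_l (b - a l) + d = 3 * b)%N.
  rewrite (bigD1 i) //= (bigD1 j) 1?eq_sym //= big1 ?addn0; first lia.
  by move=> l /andP[li lj]; rewrite aE ?subnn.
have sumB T : (\sum_l (b - a l) =
    \sum_(l in T) (b - a l) + \sum_(l | l \notin T) (b - a l))%N.
  by rewrite (bigID (mem T)).
have BE l : (l \in B) = (b - a l != 0)%N by rewrite inE -lt0n subn_gt0.
have dgE T : #|T| = 3%N -> dg T a = (d + \sum_(l | l \notin T) (b - a l))%N.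
  by move=> T3; have := defsum T T3; have := sumB T; lia.
split=> [|l|l|T T3].
- rewrite -[2%N]/(true.+1) -ij -cards2; apply/subset_leq_card/fintype.subsetP => l.
  rewrite !inE; apply: contraLR; rewrite negb_or => /andP[li lj].
  by rewrite aE // ltnn.
- by rewrite inE -leqNgt => ba; apply/eqP; rewrite eqn_leq a_le.
- by rewrite inE.
- rewrite (dgE T T3); split; first exact: leq_addr.
  split=> [/eqP|BT].
    rewrite -[X in _ == X]addn0 eqn_add2l sum_nat_eq0 => /forallP h.
    apply/fintype.subsetP => l; rewrite BE; apply: contraNT => lT.
    by have := h l; rewrite lT.
  rewrite big1 ?addn0 // => l; apply: contraNeq; rewrite -BE.
  exact: (fintype.subsetP BT).
Qed.

Lemma mintype_sym3 d a : mintype d a -> sym3 d a.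
Proof.
by case/mintype_small=> b [B [_ _ _ h]]; apply/sym3P => T /h[].
Qed.

(** At least one of the three indices carries the largest exponent, which is also
    the exponent of every index outside [T]. *)
Lemma mintype_restr_inj d a a' T : #|T| = 3%N -> mintype d a -> mintype d a' ->
  dg T a = d -> dg T a' = d -> restr T a = restr T a' -> a = a'.
Proof.
move=> T3 /mintype_small[b [B [B2 Bb Blt BT]]] /mintype_small[b' [B' [B'2 B'b B'lt B'T]]].
move=> /(proj1 (proj2 (BT T T3))) sBT /(proj1 (proj2 (B'T T T3))) sB'T /mnmP aa'.
have aT l : l \in T -> a l = a' l by move=> lT; have := aa' l; rewrite !restrE lT.
have le l : (a l <= b)%N.
  by have [/Blt/ltnW|/Bb->] := boolP (l \in B).
have le' l : (a' l <= b')%N.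
  by have [/B'lt/ltnW|/B'b->] := boolP (l \in B').
have small_notin (C : {set 'I_s}) : (#|C| <= 2)%N -> exists2 l, l \in T & l \notin C.
  move=> C2; have : ~~ (T \subset C).
    by apply: contraL C2 => /subset_leq_card; rewrite T3 -ltnNge.
  by case/subsetPn=> l; exists l.
have bb' : b = b'.
  have [l lT lB] := small_notin B B2; have [l' l'T l'B'] := small_notin B' B'2.
  have := Bb l lB; have := B'b l' l'B'; have := aT l lT; have := aT l' l'T.
  by have := le l'; have := le' l; lia.
apply/mnmP => l; have [/aT//|lT] := boolP (l \in T).
rewrite Bb ?B'b //; first by apply: contra lT; exact: (fintype.subsetP sB'T).
by apply: contra lT; exact: (fintype.subsetP sBT).
Qed.

(** Truncate the exponents at the third smallest one. *)
Lemma tight_mintype d a T : sym3 d a -> #|T| = 3%N -> dg T a = d ->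
  exists2 a', mintype d a' & (a' <= a)%MM.
Proof.
move=> /sym3P sa T3 da.
have [x xT] : exists x, x \in T by apply/set0Pn; rewrite -card_gt0 T3.
pose h := [arg max_(l > x in T) a l].
have [hT hmax] : h \in T /\ forall l, l \in T -> (a l <= a h)%N.
  by rewrite /h; case: arg_maxnP => // l lT lmax; split=> // j /lmax.
have /cards2P[i [j [ij defT]]] : #|(T :\ h)%SET| == 2%N.
  by rewrite -eqSS -T3 (cardsD1 h T) hT.
have [ih iT] : i != h /\ i \in T.
  by have := set21 i j; rewrite -defT !inE => /andP[].
have [jh jT] : j != h /\ j \in T.
  by have := set22 i j; rewrite -defT !inE => /andP[].
have sumij (f : 'I_s -> nat) : (\sum_(l in (T :\ h)%SET) f l = f i + f j)%N.
  by rewrite defT big_setU1 ?inE //= big_set1.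
have defd : (a h + (a i + a j) = d)%N by rewrite -sumij -big_setD1.
have outT l : l != i -> l != j -> (a h <= a l)%N.
  move=> li lj; have [->//|lh] := eqVneq l h.
  have lT : l \notin (T :\ h)%SET by rewrite defT !inE negb_or li.
  have := sa (l |: (T :\ h))%SET; rewrite cardsU1 lT defT cards2 ij => /(_ erefl).
  by rewrite -defT /dg big_setU1 //= sumij; lia.
exists [multinom minn (a l) (a h) | l < s]; last first.
  by apply/mnm_lepP => l; rewrite mnmE geq_minl.
exists i, j, (a h); have := hmax i iT; have := hmax j jT => aj ai.
split=> // [| | |l li lj]; rewrite !mnmE ?geq_minr //; last exact/minn_idPr/outT.
by rewrite (minn_idPl ai) (minn_idPl aj); lia.
Qed.

Lemma not_sym3 d a : ~~ sym3 d.+1 a -> sym3 d a ->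
  exists T, #|T| = 3%N /\ dg T a = d.
Proof.
rewrite negb_forall => /existsP[T]; rewrite negb_imply -ltnNge ltnS.
move=> /andP[/eqP T3 Td] /sym3P /(_ T T3) dT; exists T; split=> //.
by apply/eqP; rewrite eqn_leq Td.
Qed.

Lemma sym3_step d a : sym3 d a ->
  sym3 d.+1 a \/ exists2 a', mintype d a' & (a' <= a)%MM.
Proof.
move=> sa; have [|/not_sym3/(_ sa)[T [T3 da]]] := boolP (sym3 d.+1 a); first by left.
by right; exact: tight_mintype sa T3 da.
Qed.

Lemma card3_set : (2 < s)%N -> exists T : {set 'I_s}, #|T| = 3%N.
Proof.
move=> s3; have s2 := ltnW s3; have s1 := ltnW s2.
exists (Ordinal s1 |: [set Ordinal s2; Ordinal s3])%SET.
by rewrite cardsU1 cards2 !inE.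
Qed.

(** If no sum over three indices equals [d], lowering any positive exponent by one
    keeps them all at least [d]. *)
Lemma sym3_mintype d a : (2 < s)%N -> sym3 d a ->
  exists2 a', mintype d a' & (a' <= a)%MM.
Proof.
move=> s3; have [k] := ubnP (mdeg a); elim: k a => // k IHk a; rewrite ltnS => ak sa.
have [/sym3P sSa|//] := sym3_step sa.
have [T T3] := card3_set s3.
have : (0 < dg T a)%N by apply: leq_trans (sSa T T3).
case/dg_gt0P=> l _ al.
have defa : (a - U_(l) + U_(l) = a)%MM by rewrite submK // lep1mP -lt0n.
have [||a' mina' a'a] := IHk (a - U_(l))%MM.
- by move: ak; rewrite -{1}defa mdegD mdeg1 addn1.
- apply/sym3P => T' T'3; have := sSa T' T'3; rewrite -{1}defa dgD dgU.
  by case: (l \in T'); lia.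
- exists a' => //; apply: lepm_trans a'a _; exact: lem_subr.
Qed.

End StarMonomials.

Section Intersection.
Variables (R : comNzRingType) (s : nat) (F : 'I_s -> R).
Implicit Types (a : 'X_{1..s}) (T B E : {set 'I_s}).
Hypothesis s3 : (2 < s)%N.
Hypothesis regF : forall T l, (#|T| <= 3)%N -> l \notin T -> nzd_mod (Jid F T) (F l).

Lemma mintype_tight d a : mintype d a -> exists T, #|T| = 3%N /\ dg T a = d.
Proof.
case=> i [j [b [ij _ _ <- aE]]].
have [h] : exists h, h \notin [set i; j]%SET.
  have : ~~ ([set: 'I_s]%SET \subset [set i; j]%SET).
    by apply: contraL s3 => /subset_leq_card; rewrite cardsT card_ord cards2 ij -leqNgt.
  by case/subsetPn=> h _; exists h.
rewrite !inE negb_or => /andP[hi hj]; exists (h |: [set i; j])%SET.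
rewrite cardsU1 cards2 ij !inE negb_or hi hj; split=> //.
by rewrite /dg !big_setU1 ?inE ?negb_or ?hi //= big_set1 aE // addnC.
Qed.

Lemma mintype_leading_coef d (P : {mpoly R[s]}) a T :
  (forall b, b \in msupp P -> mintype d b \/ sym3 d.+1 b) -> mintype d a ->
  #|T| = 3%N -> dg T a = d -> Mpow F T d.+1 P.@[F] -> Jid F T P@_a.
Proof.
move=> UP mina T3 da PT.
apply: (leading_coef_in regF _ _ PT) => //; rewrite ?T3 // => b /UP[minb|/sym3P/(_ T T3)].
- exact/(sym3P _ _ (mintype_sym3 minb)).
- exact: ltnW.
- move=> ba; apply/esym/(mintype_restr_inj T3 mina minb) => //.
  by rewrite -mdeg_restr ba mdeg_restr.
- by move=> db ba; move: db; rewrite -mdeg_restr ba mdeg_restr da ltnn.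
Qed.

Definition comon E : 'X_{1..s} := [multinom (l \notin E : nat) | l < s].

Lemma mmap1_comon E : mmap1 F (comon E) = \prod_(l | l \notin E) F l.
Proof.
rewrite /mmap1 [RHS]big_mkcond; apply: eq_bigr => l _.
by rewrite mnmE; case: (l \notin E).
Qed.

Lemma dg_comon T E : #|T| = 3%N -> (#|E| <= 2)%N -> (0 < dg T (comon E))%N.
Proof.
move=> T3 E2; apply/dg_gt0P; have : ~~ (T \subset E).
  by apply: contraL E2 => /subset_leq_card; rewrite T3 -ltnNge.
by case/subsetPn=> l lT lE; exists l; rewrite ?mnmE ?lE.
Qed.

(** The leading coefficients of an element of the intersection of the [d.+1]-st
    powers lie in every [Jid T] with [T] containing the set [B] of indices of
    small exponent, hence in the ideal described by [star_inter]; multiplying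
    the monomial by a generator of that ideal raises its degree with respect to
    all sets of three indices. *)
Lemma sym3_succ d f : mon_ideal F (sym3 d) f ->
  (forall T, #|T| = 3%N -> Mpow F T d.+1 f) -> mon_ideal F (sym3 d.+1) f.
Proof.
move=> fd fT; pose U a := mintype d a \/ sym3 d.+1 a.
have : mon_ideal F U f.
  move: f fd {fT}; apply: mon_ideal_min (mon_ideal_is_ideal _ _) _ => a.
  case/sym3_step=> [sa|[a' mina' a'a]]; first by apply: mon_ideal_gen; right.
  rewrite -(submK a'a) mmap1D; case: (mon_ideal_is_ideal F U) => _ _; apply.
  by apply: mon_ideal_gen; left.
case=> P UP fP; have idL := mon_ideal_is_ideal F (sym3 d.+1).
rewrite fP meval_sum_supp big_seq; apply: is_ideal_sum => // a aP.
have [mina|sa] := UP a aP; last by case: idL => _ _; apply; exact: mon_ideal_gen.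
have [b [B [B2 _ _ BT]]] := mintype_small mina.
have : ideal_of (star_gen F B [set: 'I_s]%SET) P@_a.
  apply: (star_inter regF) => // [|T sBT _ T3]; first by rewrite cardsT card_ord ltnW.
  by apply: (mintype_leading_coef UP) => //; [apply/(proj2 (BT T T3))|rewrite -fP; exact: fT].
apply: (@ideal_of_min _ _ [set y | mon_ideal F (sym3 d.+1) (y * mmap1 F a)]).
  exact: colon_ideal.
move=> _ [[l lB ->]|[E [BE _ E2 ->]]] /=.
  rewrite -(mmap1U F l) -mmap1D; apply: mon_ideal_gen; apply/sym3P => T T3.
  have [da BTE] := BT T T3; rewrite dgD dgU.
  have [lT|lT] := boolP (l \in T); first by rewrite add1n ltnS.
  rewrite add0n ltn_neqAle da andbT eq_sym; apply: contra lT => /eqP.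
  by move=> /(proj1 BTE)/fintype.subsetP; apply.
have -> : \prod_(l in [set: 'I_s]%SET :\: E) F l = mmap1 F (comon E).
  by rewrite mmap1_comon; apply: eq_bigl => l; rewrite !inE andbT.
rewrite -mmap1D; apply: mon_ideal_gen; apply/sym3P => T T3.
by rewrite dgD -add1n leq_add ?dg_comon ?E2 //; case: (BT T T3).
Qed.

Theorem sym3_inter m f : (forall T, #|T| = 3%N -> Mpow F T m f) ->
  mon_ideal F (sym3 m) f.
Proof.
elim: m => [|m IHm] fT; last first.
  by apply: sym3_succ => //; apply: IHm => T /fT; exact: MpowS.
by exists f%:MP; rewrite ?mevalC // => a _; apply/sym3P.
Qed.

Lemma sym3_Mpow m T : #|T| = 3%N -> mon_ideal F (sym3 m) `<=` Mpow F T m.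
Proof. by move=> T3; apply: mon_idealS => a /sym3P; apply. Qed.

Lemma sym3_mintypeE m : mon_ideal F (sym3 m) = mon_ideal F (mintype m).
Proof.
rewrite eqEsubset; split; last first.
  by apply: mon_idealS => a; exact: mintype_sym3.
apply: mon_ideal_min (mon_ideal_is_ideal _ _) _ => a.
case/(sym3_mintype s3)=> a' mina' a'a.
rewrite -(submK a'a) mmap1D; case: (mon_ideal_is_ideal F (mintype m)) => _ _; apply.
exact: mon_ideal_gen.
Qed.

End Intersection.

(** * Polynomial rings over a field are Noetherian *)

Lemma tail_min (v : nat -> nat) N :
  exists i, (N <= i)%N /\ forall j, (i <= j)%N -> (v i <= v j)%N.
Proof.
suff min_from w i : v i = w -> (N <= i)%N ->
    exists i, (N <= i)%N /\ forall j, (i <= j)%N -> (v i <= v j)%N.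
  exact: (min_from _ N).
elim/ltn_ind: w i => w IHw i vi Ni.
have [|nmin] := pselect (forall j, (i <= j)%N -> (v i <= v j)%N); first by exists i.
have [j] := (existsNP _).2 nmin; rewrite not_implyP => -[ij /negP].
by rewrite -ltnNge vi => /IHw; apply=> //; exact: leq_trans ij.
Qed.

Lemma nondecreasing_subseq (v : nat -> nat) : exists2 phi : nat -> nat,
  {homo phi : i j / (i < j)%N} &
  forall i j, (i <= j)%N -> (v (phi i) <= v (phi j))%N.
Proof.
have [g gP] := choice (tail_min v).
pose phi := fix phi i := if i is i'.+1 then g (phi i').+1 else g 0%N.
have phiS i : (phi i < phi i.+1)%N by have [] := gP (phi i).+1.
have phi_lt : {homo phi : i j / (i < j)%N} by apply: homo_ltn => //; exact: ltn_trans.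
exists phi => // i j; rewrite leq_eqVlt => /predU1P[->//|ij].
have [N phiN] : exists N, phi i = g N by case: i {ij} => [|i]; eexists.
by rewrite phiN; apply: (proj2 (gP N)); rewrite -phiN ltnW // phi_lt.
Qed.

(** Extract successively, for each variable, a subsequence along which its
    exponent does not decrease. *)
Lemma dickson n (u : nat -> 'X_{1..n}) :
  exists i j, (i < j)%N /\ (u i <= u j)%MM.
Proof.
suff [phi phi_lt uphi] : exists2 phi : nat -> nat, {homo phi : i j / (i < j)%N} &
    forall l, l \in enum 'I_n -> forall i j, (i <= j)%N -> (u (phi i) l <= u (phi j) l)%N.
  exists (phi 0%N), (phi 1%N); split; first exact: phi_lt.
  by apply/mnm_lepP => l; apply: uphi; rewrite ?mem_enum.
elim: (enum 'I_n) => [|l r [phi phi_lt uphi]]; first by exists id.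
have [psi psi_lt upsi] := nondecreasing_subseq (fun i => u (phi i) l).
exists (phi \o psi) => [i j ij|l' + i j ij].
  by apply: phi_lt; exact: psi_lt.
rewrite inE => /predU1P[->|l'r]; first exact: upsi.
apply: uphi => //; move: ij; rewrite leq_eqVlt => /predU1P[->//|ij].
by rewrite ltnW // psi_lt.
Qed.

(** Stated as the maximal condition, the form in which it yields associated
    primes. *)
Definition noetherian_ring (R : comNzRingType) := forall X : set (set R),
  (forall I, X I -> is_ideal I) -> (exists I, X I) ->
  exists2 I, X I & forall J, X J -> I `<=` J -> J `<=` I.

Section Noetherian.
Variables (k : fieldType) (n : nat).
Implicit Types (I J : set {mpoly k[n]}).

Lemma least_mlead (X : set {mpoly k[n]}) : (exists f, X f) ->
  exists f, X f /\ forall g, X g -> ~~ (mlead g < mlead f)%O.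
Proof.
case=> f; move: {-1}(mlead f) (erefl (mlead f)) => a.
elim/(well_founded_ind (@ltom_wf n)): a f => a IHa f fa Xf.
have [|nmin] := pselect (forall g, X g -> ~~ (mlead g < mlead f)%O); first by exists f.
have [g] := (existsNP _).2 nmin; rewrite not_implyP => -[Xg /negP].
by rewrite negbK fa => /IHa; apply.
Qed.

(** Along a strictly increasing sequence of ideals, choose at each step a new
    element of least leading monomial; when one of these monomials divides a
    later one, cancelling the leading term of the later element gives a new
    element with a smaller leading monomial. *)
Lemma no_increasing_ideals (I : nat -> set {mpoly k[n]}) :
  (forall i, is_ideal (I i)) -> ~ forall i, I i `<=` I i.+1 /\ ~ I i.+1 `<=` I i.
Proof.
move=> idI Iincr.
have Isub i j : (i <= j)%N -> I i `<=` I j.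
  elim: j => [|j IHj]; rewrite leq_eqVlt => /predU1P[->//|] //.
  by rewrite ltnS => /IHj Iij f /Iij /(proj1 (Iincr j)).
have new_elt i : exists f, (I i.+1 f /\ ~ I i f) /\
    forall g, I i.+1 g /\ ~ I i g -> ~~ (mlead g < mlead f)%O.
  apply: (@least_mlead [set g | I i.+1 g /\ ~ I i g]).
  have [_ /(existsNP _).2[g]] := Iincr i.
  by rewrite not_implyP; exists g.
have [f fP] := choice new_elt.
have [i [j [ij aij]]] := dickson (fun i => mlead (f i)).
have [[Ifi _] _] := fP i; have [[Ifj nIfj] minfj] := fP j.
have nz i' : f i' != 0.
  have [[_ nI] _] := fP i'; apply/eqP => fi0; apply: nI; rewrite fi0.
  by case: (idI i').
pose c := mleadc (f j) / mleadc (f i).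
pose h := c *: ('X_[mlead (f j) - mlead (f i)] * f i).
have nzc : c != 0 by rewrite mulf_neq0 ?invr_eq0 ?mleadc_eq0.
have nzX : 'X_[mlead (f j) - mlead (f i)] != 0 :> {mpoly k[n]}.
  by apply/eqP => /(congr1 (mcoeff (mlead (f j) - mlead (f i))%MM))/eqP;
    rewrite mcoeffX eqxx mcoeff0 oner_eq0.
have leadh : mlead h = mlead (f j).
  by rewrite mleadZ // mleadM // mleadXm submK.
have Ih : I j h.
  have [_ _ IM] := idI j; rewrite /h scalerAl; apply: IM.
  exact: Isub ij _ Ifi.
have Jg : I j.+1 (f j - h) /\ ~ I j (f j - h).
  split; first by apply: is_idealB => //; apply: (Isub j).
  move=> Ig; apply: nIfj; rewrite -(subrK h (f j)).
  by have [_ ID _] := idI j; exact: ID.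
have nzg : f j - h != 0.
  by apply/eqP => g0; case: Jg => _; rewrite g0; apply; case: (idI j).
apply/negP: (minfj _ Jg); rewrite negbK lt_neqAle; apply/andP; split; last first.
  by apply: le_trans (mleadB_le _ _) _; rewrite leadh joinxx.
apply: contraTneq (mlead_supp nzg) => ->; rewrite -mcoeff_eq0 mcoeffB subr_eq0.
have : h@_(mlead (f j) - mlead (f i) + mlead (f i)) = mleadc (f j).
  by rewrite mcoeffZ [_ * f i]mulrC mcoeffMX divfK // mleadc_eq0.
by rewrite submK // => ->.
Qed.

Lemma noetherian : noetherian_ring {mpoly k[n]}.
Proof.
move=> X idX [I0 XI0]; apply: contrapT => nmax.
have next (I : {I | X I}) : exists J : {I | X I},
    sval I `<=` sval J /\ ~ sval J `<=` sval I.
  case: I => I XI; apply: contrapT => nJ; apply: nmax; exists I => // J XJ IJ.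
  by apply: contrapT => nJI; apply: nJ; exists (exist _ J XJ).
have [nxt nxtP] := choice next.
pose I i := sval (iter i nxt (exist _ I0 XI0)).
apply: (@no_increasing_ideals I) => i; last exact: nxtP.
by apply: idX; exact: svalP.
Qed.

End Noetherian.

(** * Symbolic powers *)

Lemma ideal_pow_mon (R : comNzRingType) s (F : 'I_s -> R) (I : set R)
    (U : nat -> 'X_{1..s} -> Prop) m :
  I `<=` mon_ideal F (U 1%N) -> U 0%N 0%MM ->
  (forall d a b, U 1%N a -> U d b -> U d.+1 (a + b)%MM) ->
  ideal_pow I m `<=` mon_ideal F (U m).
Proof.
move=> IU U0 UD; apply: ideal_of_min (mon_ideal_is_ideal _ _) _ => _ [x Ix ->].
elim: m x Ix => [|m IHm] x Ix.
  by rewrite big_ord0 -(mmap11 F); exact: mon_ideal_gen.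
rewrite big_ord_recl; apply: (mon_idealM (@UD m)); first exact/IU/Ix.
by apply: IHm => i; exact: Ix.
Qed.

Lemma prime_prod (R : comNzRingType) (P : set R) (J : Type) (r : seq J)
    (Q : pred J) (x : J -> R) : is_prime_ideal P ->
  (forall j, Q j -> ~ P (x j)) -> ~ P (\prod_(j <- r | Q j) x j).
Proof.
by case=> _ P1 PM nPx; elim/big_ind: _ => // y z nPy nPz /PM[].
Qed.

Section ExtensionContraction.
Variable R : idomainType.
Implicit Types (P J : set R).

Lemma ext_contrP P J f : is_prime_ideal P -> is_ideal J ->
  ext_contr P J f <-> exists u, ~ P u /\ J (u * f).
Proof.
move=> prP idJ; have [[P0 _ _] P1 PM] := prP.
have nz u : ~ P u -> tofrac u != 0.
  by move=> nPu; rewrite tofrac_eq0; apply: contra_notN nPu => /eqP->.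
split=> [[n [c [x [cx fE]]]]|[u [nPu Juf]]]; last first.
  exists 1%N, (fun=> tofrac 1 / tofrac u), (fun=> u * f); split.
    by move=> _; split=> //; exists 1, u.
  by rewrite big_ord1 tofracM tofrac1 mul1r mulKf ?nz.
have frac_c i : exists au, ~ P au.2 /\ c i = tofrac au.1 / tofrac au.2.
  by have [[a [u [nPu ->]]] _] := cx i; exists (a, u).
have [au auP] := choice frac_c.
exists (\prod_i (au i).2); split.
  by apply: prime_prod => // i _; case: (auP i).
have -> : \prod_i (au i).2 * f =
    \sum_i (\prod_(j | j != i) (au j).2 * (au i).1) * x i.
  apply/eqP; rewrite -tofrac_eq tofracM fE mulr_sumr raddf_sum /=; apply/eqP.
  apply: eq_bigr => i _; have [nPu ->] := auP i.
  rewrite (bigD1 i) //= !tofracM; field.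
  exact: nz.
apply: is_ideal_sum => // i _; case: idJ => _ _; apply.
by case: (cx i).
Qed.

End ExtensionContraction.

(** Among the ideals (J : f) containing (J : c), with f outside J, a maximal one
    is prime. *)
Lemma associated_prime_above (R : comNzRingType) (J : set R) c :
  noetherian_ring R -> is_ideal J -> ~ J c -> exists f, [/\ is_prime_ideal [set g | J (g * f)]
    & forall u, J (u * c) -> J (u * f)].
Proof.
move=> noethR idJ nJc; have [J0 JD JM] := idJ.
pose X : set (set R) := [set A | exists f, [/\ ~ J f, A = [set g | J (g * f)] &
  forall u, J (u * c) -> J (u * f)]].
have [||_ [f [nJf -> cf]] maxf] := noethR X.
- by move=> _ [f [_ -> _]]; exact: colon_ideal.
- by exists [set g | J (g * c)], c.
exists f; split=> //; split=> [||x y /= Jxy]; first exact: colon_ideal.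
  by rewrite /= mul1r.
have [Jyf|nJyf] := pselect (J (y * f)); [by right|left].
have Xy : X [set g | J (g * (y * f))].
  exists (y * f); split=> // u Juc; rewrite mulrCA; apply: JM; exact: cf.
apply: (maxf _ Xy); last by rewrite /= mulrA.
by move=> g /= Jgf; rewrite mulrCA; exact: JM.
Qed.

Section SymbolicStar.
Variables (R : idomainType) (s : nat) (F : 'I_s -> R).
Implicit Types (a : 'X_{1..s}) (T B E : {set 'I_s}).
Hypothesis noethR : noetherian_ring R.
Hypothesis s3 : (2 < s)%N.
Hypothesis regF : forall T l, (#|T| <= 3)%N -> l \notin T -> nzd_mod (Jid F T) (F l).

Definition star3 : set R := [set f | forall T, #|T| = 3%N -> Jid F T f].

Lemma Jid_outer T T' x : #|T| = 3%N -> #|T'| = 3%N -> T' != T ->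
  Jid F T' (x * \prod_(l | l \notin T) F l).
Proof.
move=> T3 T'3 TT'; have : ~~ (T' \subset T).
  by apply: contra TT' => sT'T; rewrite eqEcard sT'T T3 T'3.
case/subsetPn=> l lT' lT; rewrite (bigD1 l) //=.
have [_ _ JM] := Jid_is_ideal F T'; apply: JM.
by apply: is_idealMr (Jid_is_ideal F T') _; apply: ideal_of_gen; exists l.
Qed.

Lemma star3_outer T x : #|T| = 3%N ->
  star3 (x * \prod_(l | l \notin T) F l) <-> Jid F T x.
Proof.
move=> T3; split=> [/(_ T T3)|Jx T' T'3].
  rewrite mulrC; apply: nzd_mod_prod => l lT; apply: regF => //.
  by rewrite T3.
have [->|] := eqVneq T' T; first exact: is_idealMr (Jid_is_ideal F T) _.
exact: Jid_outer.
Qed.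

(** The prime (J_T : f) of R/J_T is also (I_3 : f G), where G is the product of the
    elements outside [T]. *)
Lemma star3_assoc_above T c : #|T| = 3%N -> ~ Jid F T c ->
  exists2 P, associated_prime star3 P & forall u, Jid F T (u * c) -> P u.
Proof.
move=> T3 nJc; have [f [prf cf]] := associated_prime_above noethR (Jid_is_ideal F T) nJc.
exists [set g | Jid F T (g * f)] => //; split=> //.
exists (f * \prod_(l | l \notin T) F l); apply/seteqP; split=> g /=.
  by move=> Jgf; rewrite mulrA; apply/star3_outer.
by rewrite mulrA => /star3_outer; apply.
Qed.

(** A prime of the form (I_3 : f) contains, hence equals, one of the finitely
    many (J_T : f) of which it is the intersection. *)
Lemma star3_assoc_outer P : associated_prime star3 P ->
  exists2 T : {set 'I_s}, #|T| = 3%N & forall l, l \notin T -> ~ P (F l).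
Proof.
case=> prP [f defP]; have [_ P1 _] := prP.
have [T [T3 TP]] : exists T : {set 'I_s}, #|T| = 3%N /\ forall g, Jid F T (g * f) -> P g.
  apply: contrapT => noT.
  have avoid T : exists x, #|T| = 3%N -> Jid F T (x * f) /\ ~ P x.
    have [T3|nT3] := pselect (#|T| = 3%N); last by exists 0.
    apply: contrapT => nx; apply: noT; exists T; split=> // x Jx.
    by apply: contrapT => nPx; apply: nx; exists x.
  have [g gP] := choice avoid.
  have : ~ P (\prod_(T : {set 'I_s} | #|T| == 3%N) g T).
    by apply: prime_prod => // T /eqP/gP[].
  apply; rewrite defP => T T3; rewrite (bigD1 T) ?T3 //= mulrAC.
  by apply: is_idealMr (Jid_is_ideal F T) _; have [] := gP T T3.
exists T => // l lT; rewrite defP => /(_ T T3) Jlf; apply: P1; apply: TP.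
by rewrite mul1r; apply: regF Jlf; rewrite ?T3.
Qed.

Lemma star3_pow_Mpow T m : #|T| = 3%N -> ideal_pow star3 m `<=` Mpow F T m.
Proof.
move=> T3; apply: (@ideal_pow_mon _ _ _ _ (fun d a => (d <= dg T a)%N)) => //.
  by move=> f /(_ T T3); rewrite -Mpow1.
by move=> d a b a1 bd; rewrite dgD -add1n leq_add.
Qed.

(** If [f] left the powers of J_T at order [d < m], its leading coefficient [c]
    in the graded ring would not be in J_T, and an associated prime containing
    (J_T : c) would contain every [u] with [u * f] in the [m]-th power of the ideal
    of the star configuration. *)
Lemma symbolic_Mpow m f T : symbolic_power star3 m f -> #|T| = 3%N -> Mpow F T m f.
Proof.
move=> fm T3; suff: forall d, (d <= m)%N -> Mpow F T d f by apply.
elim=> [_|d IHd dm].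
  by exists f%:MP; rewrite ?mevalC.
have [P PT fP] := Mpow_vars (IHd (ltnW dm)).
rewrite fP; apply: Mpow_succ => [a /PT[/mdeg_vars<-] //|a aP da].
apply: contrapT => nJa; have [Q Qass Qa] := star3_assoc_above T3 nJa.
have /(ext_contrP _ (proj1 Qass) (ideal_of_is_ideal _))[u [nQu ufm]] := fm Q Qass.
apply/nQu/Qa; rewrite -mcoeffZ.
apply: (leading_coef_in regF _ _ _ da); first by rewrite T3.
- by move=> b /msuppZ_le/PT[/mdeg_vars<-].
- by rewrite mevalZ -fP; apply: MpowS dm _ _; exact: star3_pow_Mpow.
- by move=> b /msuppZ_le/PT[Tb _]; have [Ta _] := PT a aP; rewrite !restr_id.
Qed.

Lemma star3_pow_outer T m a : #|T| = 3%N -> (m <= dg T a)%N ->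
  ideal_pow star3 m ((\prod_(l | l \notin T) F l) ^+ m * mmap1 F a).
Proof.
move=> T3; elim: m a => [|m IHm] a da.
  rewrite expr0 mulrC; case: (ideal_of_is_ideal [set x | exists2 y : 'I_0 -> R,
    (forall i, star3 (y i)) & x = \prod_(i < 0) y i]) => _ _; apply.
  by apply: ideal_of_gen; exists (fun=> 0); rewrite ?big_ord0 // => -[].
have [t tT at0] := dg_gt0P _ _ (leq_ltn_trans (leq0n m) da).
rewrite (mmap1_split F at0) exprS mulrACA; apply: ideal_powS.
  rewrite mulrC; apply/star3_outer => //.
  by apply: ideal_of_gen; exists t.
apply: IHm; move: da; rewrite -{1}(@submK _ U_(t)%MM a) ?lep1mP -?lt0n //.
by rewrite dgD dgU tT addn1.
Qed.

(** An associated prime avoids the [F l] with [l] outside some [T], and the [m]-th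
    power of their product carries J_T^m into I_3^m. *)
Lemma Mpow_symbolic m f : (forall T, #|T| = 3%N -> Mpow F T m f) ->
  symbolic_power star3 m f.
Proof.
move=> fT P Pass; have prP := proj1 Pass; apply/(ext_contrP _ prP).
  exact: ideal_of_is_ideal.
have [T T3 PT] := star3_assoc_outer Pass.
exists ((\prod_(l | l \notin T) F l) ^+ m); split.
  rewrite -[m]card_ord -prodr_const; apply: prime_prod => [|_ _]; first exact: prP.
  exact: prime_prod.
rewrite mulrC; have {fT} := fT T T3; move: f.
apply: (@mon_ideal_min _ _ _ _
    [set f | ideal_pow star3 m (f * (\prod_(l | l \notin T) F l) ^+ m)]).
  exact: colon_ideal (ideal_of_is_ideal _).
by move=> a da; rewrite /= mulrC; exact: star3_pow_outer.
Qed.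

Theorem symbolic_star3 m : symbolic_power star3 m = mon_ideal F (mintype m).
Proof.
rewrite -(sym3_mintypeE F s3); apply/seteqP; split=> f.
  by move=> fm; apply: (sym3_inter s3 regF) => T; exact: symbolic_Mpow.
by move=> fm; apply: Mpow_symbolic => T T3; exact: sym3_Mpow fm.
Qed.

End SymbolicStar.

(** * Minimal generators *)

Section MinimalGenerators.
Variables (R : comNzRingType) (K : fieldType) (e : {rmorphism R -> K}).
Variables (A B : set R) (N : nat) (x : 'I_N -> R).
Hypothesis idB : is_ideal B.
Hypothesis xA : forall i, A (x i).
Hypothesis genx : forall a, A a -> exists c, B (a - \sum_i c i * x i).
Hypothesis indep : forall c, B (\sum_i c i * x i) -> forall i, e (c i) = 0.

Let X : set R := [set y | exists i, y = x i].

Lemma generates_range : generates_mod A B X.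
Proof.
split=> [_ [i ->]|a /genx[c Bac]]; first exact: xA.
exists (\sum_i c i * x i) => //; apply: is_ideal_sum => [|i _].
  exact: ideal_of_is_ideal.
by case: (ideal_of_is_ideal X) => _ _; apply; apply: ideal_of_gen; exists i.
Qed.

Lemma minimal_range : minimal_generating_set A B X.
Proof.
split=> [|Y [YX /(existsNP _).2[y]]]; first exact: generates_range.
rewrite not_implyP => -[[i0 ->] nYx] [_ /(_ _ (xA i0))[c Yc Bc]].
have /(ideal_of_fin (P := predC1 i0))[d cE] :
    ideal_of [set y | exists2 i, predC1 i0 i & y = x i] c.
  apply: ideal_ofS Yc => z Yz; have [i zx] := YX z Yz; exists i => //=.
  by apply/eqP => ii0; apply: nYx; rewrite -ii0 -zx.
have : B (\sum_i (if i == i0 then 1 else - d i) * x i).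
  rewrite (bigD1 i0) //= eqxx mul1r; move: Bc; rewrite cE -sumrN.
  congr (B (_ + _)); apply: eq_bigr => i /negbTE->; by rewrite mulNr.
by move=> /indep/(_ i0)/eqP; rewrite eqxx rmorph1 oner_eq0.
Qed.

(** Expressing the [x i] through another generating list and back gives two
    matrices whose product is the identity after applying [e]. *)
Lemma mu_range : mu_is A B N.
Proof.
split=> [|t [tA tgen]].
  exists (codom x); first by rewrite size_codom card_ord.
  have -> : [set y | y \in codom x] = X; last exact: generates_range.
  apply/seteqP; split=> [y /codomP[i ->]|_ [i ->]] /=; first by exists i.
  exact: codom_f.
pose tt i := tnth (in_tuple t) i.
have tAi i : A (tt i) by apply: tA; exact: mem_tnth.
have [E EP] := choice (fun j => genx (tAi j)).
have express i : exists d, B (x i - \sum_j d j * tt j).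
  have [c tc Bc] := tgen _ (xA i).
  have /(ideal_of_fin (P := predT))[d cE] :
      ideal_of [set y | exists2 j, predT j & y = tt j] c.
    by apply: ideal_ofS tc => y /= yt; have /tnthP[j ->] : y \in in_tuple t := yt; exists j.
  by exists d; rewrite -cE.
have [D DP] := choice express.
pose DM := \matrix_(i, j) e (D i j); pose EM := \matrix_(j, l) e (E j l).
suff : DM *m EM = 1%:M by exact: mulmx1_min.
apply/matrixP => i l; rewrite !mxE.
have : B (\sum_l ((i == l)%:R - \sum_j D i j * E j l) * x l).
  have -> : \sum_l ((i == l)%:R - \sum_j D i j * E j l) * x l =
      (x i - \sum_j D i j * tt j) + \sum_j D i j * (tt j - \sum_l E j l * x l).
    under eq_bigr => l' _ do rewrite mulrBl.
    rewrite sumrB (bigD1 i) //= eqxx mul1r big1 ?addr0; last first.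
      by move=> l'; rewrite eq_sym => /negbTE->; rewrite mul0r.
    rewrite [X in _ = _ + X](eq_bigr (fun j =>
      D i j * tt j - D i j * \sum_l E j l * x l)); last by move=> j _; rewrite mulrBr.
    rewrite sumrB addrA subrK; congr (_ - _).
    under eq_bigr => l' _ do rewrite mulr_suml.
    rewrite exchange_big /=; apply: eq_bigr => j _.
    by rewrite mulr_sumr; apply: eq_bigr => l' _; rewrite mulrA.
  have [_ BD BM] := idB; apply: BD; first exact: DP.
  by apply: is_ideal_sum => // j _; apply: BM; exact: EP.
move=> /indep/(_ l)/eqP; rewrite rmorphB rmorph_nat subr_eq0 => /eqP->.
by rewrite rmorph_sum; apply: eq_bigr => j _; rewrite !mxE rmorphM.
Qed.

End MinimalGenerators.

Section StarGenerators.
Variables (R : idomainType) (s : nat) (F : 'I_s -> R).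
Implicit Types (a : 'X_{1..s}) (T E : {set 'I_s}).
Hypothesis noethR : noetherian_ring R.
Hypothesis s4 : (3 < s)%N.
Hypothesis regF : forall T l, (#|T| <= 3)%N -> l \notin T -> nzd_mod (Jid F T) (F l).
Variables (K : fieldType) (e : {rmorphism R -> K}).
Hypothesis eF : forall l, e (F l) = 0.

Let s3 : (2 < s)%N := ltnW s4.

Lemma eJid T x : Jid F T x -> e x = 0.
Proof.
apply: (@ideal_of_min _ _ [set x | e x = 0]) => [|_ [l _ ->] //].
split=> [|a b /= ea eb|c a /= ea]; first exact: rmorph0.
  by rewrite rmorphD ea eb addr0.
by rewrite rmorphM ea mulr0.
Qed.

Lemma e_mmap1 a : a != 0%MM -> e (mmap1 F a) = 0.
Proof.
move=> a0; have /existsP[l al] : [exists l, a l != 0%N].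
  apply: contraNT a0 => /existsPn h; apply/eqP/mnmP => l.
  by rewrite mnm0E; apply/eqP; rewrite -[_ == _]negbK.
by rewrite (mmap1_split F (l := l)) ?lt0n // rmorphM eF mul0r.
Qed.

Lemma mintype_indep m (P : {mpoly R[s]}) a :
  (forall b, b \in msupp P -> mintype m b) -> P.@[F] = 0 -> e P@_a = 0.
Proof.
move=> mP P0; have [aP|/memN_msupp_eq0->] := boolP (a \in msupp P); last exact: rmorph0.
have mina := mP a aP; have [T [T3 da]] := mintype_tight s3 mina.
apply: (@eJid T); apply: (mintype_leading_coef (F := F) regF _ mina T3 da).
  by move=> b /mP; left.
by rewrite P0; case: (mon_ideal_is_ideal F (fun a => (m < dg T a)%N)).
Qed.

Section List.
Variables (m : nat) (r : seq 'X_{1..s}).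
Hypothesis uniq_r : uniq r.
Hypothesis min_r : forall a, a \in r -> mintype m a.

Let x (i : 'I_(size r)) := mmap1 F (tnth (in_tuple r) i).

Lemma list_indep (c : 'I_(size r) -> R) (Q : {mpoly R[s]}) :
  (forall b, b \in msupp Q -> mintype m b) -> (forall a, a \in r -> e Q@_a = 0) ->
  \sum_i c i * x i = Q.@[F] -> forall i, e (c i) = 0.
Proof.
move=> mQ eQ cQ i; pose P := \sum_i c i *: 'X_[tnth (in_tuple r) i] - Q.
have : e P@_(tnth (in_tuple r) i) = 0.
  apply: (@mintype_indep m).
    move=> b /msuppB_le; rewrite mem_cat => /orP[|/mQ //].
    move=> /msupp_sum_le/flatten_mapP[j _ /msuppZ_le]; rewrite msuppX inE => /eqP->.
    by apply: min_r; exact: mem_tnth.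
  rewrite mevalB -cQ raddf_sum /= -sumrB big1 // => j _.
  by rewrite mevalZ mevalXE subrr.
rewrite mcoeffB raddfB /= [X in _ - X]eQ ?mem_tnth // subr0 raddf_sum /=.
rewrite (bigD1 i) //= mcoeffZ mcoeffX eqxx mulr1 big1 ?addr0 // => j ji.
rewrite mcoeffZ mcoeffX; case: eqP => [|_]; rewrite ?mulr0 //.
move=> /(congr1 (index^~ r)); rewrite !(tnth_nth 0%MM) /= !index_uniq //.
by move=> /val_inj/eqP; rewrite (negbTE ji).
Qed.

Lemma list_generates (B : set R) : is_ideal B ->
  (forall a, mintype m a -> a \in r \/ B (mmap1 F a)) ->
  forall f, mon_ideal F (mintype m) f -> exists c, B (f - \sum_i c i * x i).
Proof.
move=> idB gen; have [B0 BD BM] := idB.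
pose I : set R := [set f | exists c, B (f - \sum_i c i * x i)].
have idI : is_ideal I.
  split=> [|f g [c Bc] [d Bd]|h f [c Bc]].
  - by exists (fun=> 0); rewrite big1 ?subr0 // => i _; rewrite mul0r.
  - exists (fun i => c i + d i); under eq_bigr do rewrite mulrDl.
    by rewrite big_split /= opprD addrACA; exact: BD.
  - exists (fun i => h * c i); under eq_bigr do rewrite -mulrA.
    by rewrite -mulr_sumr -mulrBr; exact: BM.
apply: (@mon_ideal_min _ _ _ _ I) => // a /gen[|Ba]; last first.
  by exists (fun=> 0); rewrite big1 ?subr0 // => i _; rewrite mul0r.
move=> ar; have /tnthP[i ai] : a \in in_tuple r := ar; exists (fun j => (j == i)%:R).
rewrite (bigD1 i) //= eqxx mul1r big1 ?addr0 ?/x ?ai ?subrr // => j /negbTE->.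
by rewrite mul0r.
Qed.

End List.

(** * Powers of the ideal of the star configuration *)

Lemma mintype_full m a l : mintype m a -> (m <= a l)%N ->
  exists i j, [/\ i != j, a i = 0%N, a j = 0%N &
                  forall h, h != i -> h != j -> a h = m].
Proof.
case=> i [j [b [ij aib ajb defm aE]]] ml.
have bm : b = m.
  have : (a l <= b)%N.
    by have [->//|li] := eqVneq l i; have [->//|lj] := eqVneq l j; rewrite aE.
  by lia.
by exists i, j; split=> [| | |h hi hj] //; [lia|lia|rewrite aE].
Qed.

Lemma star3_comon i j : i != j -> star3 F (mmap1 F (comon [set i; j]%SET)).
Proof.
move=> ij T T3; rewrite -Mpow1; apply: mon_ideal_gen.
by rewrite dg_comon // cards2 ij.
Qed.

Lemma mintype_full_pow m a l : mintype m a -> (m <= a l)%N ->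
  ideal_pow (star3 F) m (mmap1 F a).
Proof.
move=> /mintype_full + ml => /(_ l ml)[i [j [ij ai aj aE]]].
have -> : mmap1 F a = mmap1 F (comon [set i; j]%SET) ^+ m.
  rewrite /mmap1 -prodrXl; apply: eq_bigr => h _; rewrite -exprM; congr (_ ^+ _).
  rewrite mnmE !inE; have [->|hi] := eqVneq h i; first by rewrite ai.
  have [->|hj] := eqVneq h j; first by rewrite aj.
  by rewrite aE // mul1n.
exact: ideal_pow_exp (star3_comon ij).
Qed.

(** Satisfied by the exponents of the products of [m] of the G_ij. *)
Definition pow_type m a := sym3 m a /\ mdeg a = (m * (s - 2))%N.

Lemma mdeg_comon E : #|E| = 2%N -> mdeg (comon E) = (s - 2)%N.
Proof.
move=> E2; rewrite mdegE; under eq_bigr do rewrite mnmE.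
rewrite -big_mkcond /= sum1_card -[RHS](_ : #|~: E|%SET = _).
  by apply: eq_card => l; rewrite !inE.
by have := cardsC E; rewrite E2 card_ord; lia.
Qed.

Lemma star3_pow_type : star3 F `<=` mon_ideal F (pow_type 1).
Proof.
move=> f sf; have : ideal_of (star_gen F (@finset.set0 _) [set: 'I_s]%SET) f.
  apply: (star_inter regF) => [||| T _ _ T3]; rewrite ?cards0 ?finset.sub0set //.
    by rewrite cardsT card_ord ltnW.
  exact: sf.
apply: (@ideal_of_min _ _ (mon_ideal F (pow_type 1))).
  exact: mon_ideal_is_ideal.
move=> x [[l]|[E [_ _ E2 ->]]]; first by rewrite inE.
have -> : \prod_(l in [set: 'I_s]%SET :\: E) F l = mmap1 F (comon E).
  by rewrite mmap1_comon; apply: eq_bigl => l; rewrite !inE andbT.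
apply: mon_ideal_gen; split; last by rewrite mdeg_comon ?mul1n.
by apply/sym3P => T T3; rewrite dg_comon // E2.
Qed.

Lemma mdeg_mintype_at m a i j b : mintype_at m a i j b ->
  mdeg a = (m + (s - 3) * b)%N.
Proof.
case=> ij _ _ defm aE; rewrite mdegE (bigD1 i) //= (bigD1 j) 1?eq_sym //=.
rewrite (eq_bigr (fun=> b)) => [|l /andP[li lj]]; last by rewrite aE.
rewrite sum_nat_const (_ : #|_| = (s - 2)%N).
  by rewrite -defm (_ : s - 2 = (s - 3).+1)%N ?mulSn; lia.
have := cardsC [set i; j]%SET; rewrite cards2 ij card_ord => cC.
rewrite (_ : s - 2 = #|~: [set i; j]|%SET)%N; last by lia.
by apply: eq_card => l; rewrite !inE negb_or.
Qed.

(** Since [s > 3], the only minimal monomials of the degree of an [m]-fold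
    product of generators of the ideal are [m]-th powers of generators. *)
Lemma pow_type_full m a : pow_type m a -> mintype m a -> exists l, (m <= a l)%N.
Proof.
case=> _ da [i [j [b mina]]]; have := mdeg_mintype_at mina.
have [ij _ _ _ aE] := mina; rewrite da => dab.
have bm : b = m.
  have : ((s - 3) * b = (s - 3) * m)%N.
    by move: dab; rewrite (_ : s - 2 = (s - 3).+1)%N; last lia; rewrite mulnS mulnC; lia.
  by move/eqP; rewrite eqn_pmul2l ?subn_gt0 // => /eqP.
have [h] : exists h, h \notin [set i; j]%SET.
  have : ~~ ([set: 'I_s]%SET \subset [set i; j]%SET).
    by apply: contraL s3 => /subset_leq_card; rewrite cardsT card_ord cards2 ij -leqNgt.
  by case/subsetPn=> h _; exists h.
by rewrite !inE negb_or => /andP[hi hj]; exists h; rewrite aE // bm.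
Qed.

(** A monomial of an [m]-fold product either is a full power, whose exponent vector
    has an entry [m], or is a proper multiple of a minimal one and so enters with
    a coefficient vanishing under [e]. *)
Lemma star3_pow_coef m f : ideal_pow (star3 F) m f ->
  exists Q : {mpoly R[s]}, [/\ forall a, a \in msupp Q -> mintype m a,
    forall a, (forall l, (a l < m)%N) -> e Q@_a = 0 & f = Q.@[F]].
Proof.
pose W : set R := [set f | exists Q : {mpoly R[s]},
  [/\ forall a, a \in msupp Q -> mintype m a,
      forall a, (forall l, (a l < m)%N) -> e Q@_a = 0 & f = Q.@[F]]].
have idW : is_ideal W.
  split.
  - exists 0; split=> [a|a _|]; rewrite ?msupp0 ?mcoeff0 ?rmorph0 ?meval0 //.
  - move=> _ _ [P [mP eP ->]] [Q [mQ eQ ->]]; exists (P + Q).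
    split=> [a /msuppD_le|a am|]; last by rewrite mevalD.
      by rewrite mem_cat => /orP[/mP|/mQ].
    by rewrite mcoeffD rmorphD eP ?eQ ?addr0.
  - move=> c _ [P [mP eP ->]]; exists (c *: P).
    split=> [a /msuppZ_le/mP //|a am|]; last by rewrite mevalZ.
    by rewrite mcoeffZ rmorphM eP ?mulr0.
have powU : ideal_pow (star3 F) m `<=` mon_ideal F (pow_type m).
  apply: ideal_pow_mon star3_pow_type _ _ => [|d a b [/sym3P sa da] [/sym3P sb db]].
    by split; [apply/sym3P|rewrite mdeg0 mul0n].
  split; last by rewrite mdegD da db mul1n mulSn.
  by apply/sym3P => T T3; rewrite dgD -add1n leq_add ?sa ?sb.
move=> /powU; move: f; apply: (@mon_ideal_min _ _ _ _ W) => // a pa.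
have [a' mina' a'a] := sym3_mintype s3 pa.1.
exists (mmap1 F (a - a')%MM *: 'X_[a']); split.
- by move=> b /msuppZ_le; rewrite msuppX inE => /eqP->.
- move=> b bm; rewrite mcoeffZ mcoeffX; case: eqP => [a'b|_]; last by rewrite mulr0 rmorph0.
  rewrite mulr1; apply: e_mmap1; apply/eqP => aa'0.
  have aa' : a = a' by rewrite -(submK a'a) aa'0 add0m.
  have [l] := pow_type_full pa (eq_ind_r (mintype m) mina' aa').
  by rewrite aa' a'b leqNgt bm.
- by rewrite mevalZ mevalXE -mmap1D submK.
Qed.

(** To be used with [B] zero and with [B] the [m]-th power of the ideal; the last
    hypothesis makes the monomials in [P] independent modulo [B]. *)
Lemma star_minimal_mod m (r : seq 'X_{1..s}) (B : set R) (P : 'X_{1..s} -> Prop) :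
  uniq r -> (forall a, a \in r <-> P a) -> is_ideal B ->
  (forall a, P a -> mintype m a) ->
  (forall a, mintype m a -> P a \/ B (mmap1 F a)) ->
  (forall f, B f -> exists Q : {mpoly R[s]},
    [/\ forall a, a \in msupp Q -> mintype m a,
        forall a, P a -> e Q@_a = 0 & f = Q.@[F]]) ->
  minimal_generating_set (symbolic_power (star3 F) m) B
    [set f | exists2 a, P a & f = mmap1 F a] /\
  mu_is (symbolic_power (star3 F) m) B (size r).
Proof.
move=> uniq_r rP idB minP genP coefB; rewrite (symbolic_star3 noethR s3 regF).
have min_r a : a \in r -> mintype m a by move/rP/minP.
pose x (i : 'I_(size r)) := mmap1 F (tnth (in_tuple r) i).
have xA i : mon_ideal F (mintype m) (x i).
  by apply: mon_ideal_gen; apply: min_r; exact: mem_tnth.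
have genx f : mon_ideal F (mintype m) f -> exists c, B (f - \sum_i c i * x i).
  by apply: list_generates => // a /genP[/rP|]; [left|right].
have indep c : B (\sum_i c i * x i) -> forall i, e (c i) = 0.
  case/coefB=> Q [mQ eQ cQ]; apply: (list_indep uniq_r min_r mQ _ cQ) => a.
  by move/rP; exact: eQ.
split; last exact: (mu_range idB xA genx indep).
rewrite (_ : [set f | _] = [set y | exists i, y = x i]).
  exact: (minimal_range xA genx indep).
apply/seteqP; split=> [_ [a /rP ar ->]|_ [i ->]] /=.
  by have /tnthP[i ai] : a \in in_tuple r := ar; exists i; rewrite /x -ai.
by exists (tnth (in_tuple r) i) => //; apply/rP; exact: mem_tnth.
Qed.

Lemma star_minimal m r : uniq r -> (forall a, a \in r <-> mintype m a) ->
  minimal_generating_set (symbolic_power (star3 F) m) [set 0]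
    [set f | exists2 a, mintype m a & f = mmap1 F a] /\
  mu_is (symbolic_power (star3 F) m) [set 0] (size r).
Proof.
move=> uniq_r rP; apply: star_minimal_mod => // [|a|_ ->]; last 1 first.
- by exists 0; split=> [a|a _|]; rewrite ?msupp0 ?mcoeff0 ?rmorph0 ?meval0.
- by split=> [//|_ _ -> ->|c _ ->] /=; rewrite ?addr0 ?mulr0.
- by left.
Qed.

Lemma star_minimal_mod_pow m r : uniq r ->
  (forall a, a \in r <-> mintype m a /\ forall l, (a l < m)%N) ->
  minimal_generating_set (symbolic_power (star3 F) m) (ideal_pow (star3 F) m)
    [set f | exists2 a, mintype m a /\ (forall l, (a l < m)%N) & f = mmap1 F a] /\
  mu_is (symbolic_power (star3 F) m) (ideal_pow (star3 F) m) (size r).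
Proof.
move=> uniq_r rP; apply: star_minimal_mod => // [|a []//|a mina|f /star3_pow_coef].
- exact: ideal_of_is_ideal.
- have [am|/(existsNP _).2[l /negP]] := pselect (forall l, (a l < m)%N); first by left.
  by rewrite -leqNgt => ml; right; exact: mintype_full_pow ml.
- case=> Q [mQ eQ fQ]; exists Q; split=> // a [_]; exact: eQ.
Qed.

End StarGenerators.

(** * Counting the generators *)

Section Count.
Local Open Scope nat_scope.

(** The pairs of exponents (x, y) that are both smaller than [m - x - y], see
    [mem_small_pairs]; the bounds on [y] are solved so that the size is a sum. *)
Definition small_pairs m : seq (nat * nat) :=
  [seq (x, y) | x <- iota 0 m, y <- iota 0 (minn (m - x.*2) (uphalf (m - x)))].

Lemma mem_small_pairs m x y :
  ((x, y) \in small_pairs m) = (x.*2 + y < m) && (x + y.*2 < m).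
Proof.
apply/allpairsPdep/andP => [[x' [y' [+ + [-> ->]]]]|[h1 h2]].
  by rewrite !mem_iota; lia.
by exists x, y; rewrite !mem_iota; split=> //; lia.
Qed.

Lemma uniq_small_pairs m : uniq (small_pairs m).
Proof.
apply: allpairs_uniq_dep => [|x _|[x y] [x' y'] _ _ /= [-> ->] //]; exact: iota_uniq.
Qed.

Lemma size_small_pairs m :
  size (small_pairs m) = \sum_(0 <= x < m) minn (m - x.*2) (uphalf (m - x)).
Proof.
rewrite size_allpairs_dep sumnE big_map /index_iota subn0.
by apply: eq_bigr => x _; rewrite size_iota.
Qed.

(** The pairs with x = 0, then those with y = 0 < x; the other pairs are the
    translates by (1, 1) of the pairs for [m]. *)
Lemma size_small_pairs_add3 m : size (small_pairs (m + 3)) =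
  size (small_pairs m) + uphalf (m + 3) + (m %/ 2).+1.
Proof.
have halfE N : \sum_(0 <= x < N) (x.*2 <= m : nat) = minn N (m %/ 2).+1.
  elim: N => [|N IHN]; first by rewrite big_geq.
  by rewrite big_nat_recr //= IHN; lia.
rewrite !size_small_pairs (_ : m + 3 = m.+2.+1); last by lia.
rewrite big_nat_recl //= (eq_bigr (fun x => minn (m - x.*2) (uphalf (m - x)) + (x.*2 <= m : nat))).
  by rewrite big_split /= halfE !big_nat_recr //=; lia.
by move=> x _; lia.
Qed.

Lemma size_small_pairs6 q r : size (small_pairs (6 * q + r)) =
  6 * (q * q) + (2 * r + 2) * q + size (small_pairs r).
Proof.
elim: q => [|q IHq]; first by rewrite !muln0.
have -> : 6 * q.+1 + r = 6 * q + r + 3 + 3 by lia.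
rewrite !size_small_pairs_add3 IHq; nia.
Qed.

Section Counting.
Variable s : nat.
Implicit Types (a : 'X_{1..s}).
Hypothesis s3 : 2 < s.

Definition mono2 m (p : 'I_s * 'I_s) (q : nat * nat) : 'X_{1..s} :=
  [multinom if l == p.1 then q.1 else if l == p.2 then q.2 else m - q.1 - q.2 | l < s].
Definition mono1 m (i : 'I_s) b : 'X_{1..s} :=
  [multinom if l == i then m - b.*2 else b | l < s].

Definition index_pairs : seq ('I_s * 'I_s) :=
  [seq p : 'I_s * 'I_s <- enum {: 'I_s * 'I_s} | (p.1 < p.2)%N].

(** [Q] is [small_pairs m], or [small_pairs m] without (0, 0) so as to leave out
    the powers G_ij^m. *)
Definition mintypes (Q : seq (nat * nat)) m : seq 'X_{1..s} :=
  [seq mono2 m p q | p <- index_pairs, q <- Q] ++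
  [seq mono1 m i b | i <- enum 'I_s, b <- iota (m %/ 3).+1 (m %/ 2 - m %/ 3)] ++
  (if 3 %| m then [:: [multinom m %/ 3 | l < s]] else [::]).

Lemma mem_index_pairs i j : ((i, j) \in index_pairs) = (i < j).
Proof. by rewrite mem_filter mem_enum andbT. Qed.

Lemma mono2E m p q l : mono2 m p q l =
  if l == p.1 then q.1 else if l == p.2 then q.2 else m - q.1 - q.2.
Proof. exact: mnmE. Qed.

Lemma mono1E m i b l : mono1 m i b l = if l == i then m - b.*2 else b.
Proof. exact: mnmE. Qed.

Lemma exists_other (i j : 'I_s) : exists h, (h != i) && (h != j).
Proof.
have : ~~ ([set: 'I_s]%SET \subset [set i; j]%SET).
  apply: contraL s3 => /subset_leq_card; rewrite cardsT card_ord -leqNgt => ls.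
  by apply: leq_trans ls _; rewrite cards2; case: (i != j).
by case/subsetPn=> h _; rewrite !inE negb_or; exists h.
Qed.

Lemma mintype_mono2 m (i j : 'I_s) x y : i < j -> (x, y) \in small_pairs m ->
  mintype_at m (mono2 m (i, j) (x, y)) i j (m - x - y).
Proof.
move=> ij; rewrite mem_small_pairs => /andP[h1 h2].
have ij' : i != j by apply: contraTneq ij => ->; rewrite ltnn.
split=> //; rewrite ?mono2E /= ?eqxx ?(eq_sym j i) ?(negbTE ij'); [lia..|].
by move=> l /negbTE li /negbTE lj; rewrite mono2E /= li lj.
Qed.

Lemma mintype_mono1 m i j b : j != i -> m %/ 3 < b -> b <= m %/ 2 ->
  mintype_at m (mono1 m i b) i j b.
Proof.
move=> ji h1 h2; split; rewrite ?mono1E ?eqxx ?(negbTE ji) ?(eq_sym i j) //; [lia..|].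
by move=> l /negbTE li _; rewrite mono1E li.
Qed.

Lemma mintypes_mintype Q m a : {subset Q <= small_pairs m} ->
  a \in mintypes Q m -> mintype m a.
Proof.
move=> QS; rewrite !mem_cat => /or3P[/allpairsP[[[i j] [x y]] /=]|/allpairsP[[i b] /=]|].
- rewrite mem_index_pairs => -[ij /QS xyQ ->]; exists i, j, (m - x - y).
  exact: mintype_mono2.
- rewrite mem_iota => -[_ b_in ->]; have [j /andP[ji _]] := exists_other i i.
  by exists i, j, b; apply: mintype_mono1 => //; lia.
- case: ifP => // m3; rewrite inE => /eqP->.
  have i : 'I_s by exact: (Ordinal (ltnW (ltnW s3))).
  have [j /andP[ji _]] := exists_other i i; exists i, j, (m %/ 3).
  by split=> // [||||l _ _]; rewrite ?mnmE ?(eq_sym i j) //; lia.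
Qed.

Lemma mintype_cases m a : mintype m a ->
  [\/ exists (i j : 'I_s) x y, [/\ i < j, (x, y) \in small_pairs m & a = mono2 m (i, j) (x, y)],
      exists (i : 'I_s) b, [/\ m %/ 3 < b, b <= m %/ 2 & a = mono1 m i b]
    | 3 %| m /\ a = [multinom m %/ 3 | l < s]].
Proof.
case=> i [j [b [ij aib ajb defm aE]]].
have [ai|ai] := eqVneq (a i) b; have [aj|aj] := eqVneq (a j) b.
- constructor 3; split; first lia.
  apply/mnmP => l; rewrite mnmE.
  have [->|li] := eqVneq l i; first lia.
  by have [->|lj] := eqVneq l j; [lia|rewrite aE //; lia].
- constructor 2; exists j, b; split; [lia|lia|].
  apply/mnmP => l; rewrite mono1E; have [->|lj] := eqVneq l j; first lia.
  by have [->//|li] := eqVneq l i; rewrite aE.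
- constructor 2; exists i, b; split; [lia|lia|].
  apply/mnmP => l; rewrite mono1E; have [->|li] := eqVneq l i; first lia.
  by have [->//|lj] := eqVneq l j; rewrite aE.
- constructor 1; have [ltij|ltji] : i < j \/ j < i.
    by apply/orP; rewrite -neq_ltn.
  + exists i, j, (a i), (a j); split=> //; first by rewrite mem_small_pairs; lia.
    apply/mnmP => l; rewrite mono2E /=; have [->//|li] := eqVneq l i.
    by have [->//|lj] := eqVneq l j; rewrite aE //; lia.
  + exists j, i, (a j), (a i); split=> //; first by rewrite mem_small_pairs; lia.
    apply/mnmP => l; rewrite mono2E /=; have [->//|lj] := eqVneq l j.
    by have [->//|li] := eqVneq l i; rewrite aE //; lia.
Qed.

Lemma mem_mintypes m a : a \in mintypes (small_pairs m) m <-> mintype m a.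
Proof.
split; first exact: mintypes_mintype.
rewrite !mem_cat => /mintype_cases[[i [j [x [y [ij xy ->]]]]]|[i [b [h1 h2 ->]]]|[-> ->]].
- by apply/orP; left; apply: allpairs_f => //; rewrite mem_index_pairs.
- apply/or3P; constructor 2; apply: allpairs_f; rewrite ?mem_enum // mem_iota; lia.
- by apply/or3P; constructor 3; rewrite inE.
Qed.

Lemma mem_mintypes_lt m a : 0 < m ->
  a \in mintypes [seq q <- small_pairs m | q != (0, 0)] m <->
  mintype m a /\ forall l, a l < m.
Proof.
move=> m0; split=> [am|[]].
  have mina : mintype m a by apply: mintypes_mintype am => q; rewrite mem_filter => /andP[].
  split=> // l; rewrite ltnNge; apply/negP => ml.
  move: am; rewrite !mem_cat => /or3P[/allpairsP[[[i j] [x y]] /=]|/allpairsP[[i b] /=]|].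
  - move=> [_ + aE]; rewrite mem_filter mem_small_pairs => /andP[xy0 xym].
    move: ml; rewrite aE mono2E /=; case: eqP => _; [lia|case: eqP => _; first lia].
    by case: x y xy0 xym {aE} => [|x] [|y] //=; lia.
  - by rewrite mem_iota => -[_ b_in aE]; move: ml; rewrite aE mono1E; case: eqP; lia.
  - by case: ifP => // m3; rewrite inE => /eqP aE; move: ml; rewrite aE mnmE; lia.
rewrite !mem_cat => /mintype_cases[[i [j [x [y [ij xy ->]]]]]|[i [b [h1 h2 ->]]]|[-> ->]] am.
- apply/orP; left; apply: allpairs_f; rewrite ?mem_index_pairs // mem_filter xy andbT.
  apply/eqP => -[x0 y0]; have [h /andP[hi hj]] := exists_other i j.
  by have := am h; rewrite mono2E /= (negbTE hi) (negbTE hj) x0 y0 !subn0 ltnn.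
- apply/or3P; constructor 2; apply: allpairs_f; rewrite ?mem_enum // mem_iota; lia.
- by apply/or3P; constructor 3; rewrite inE.
Qed.

(** Its cardinality separates the three shapes of monomials, and it recovers the
    indices in [mono1] and [mono2]. *)
Definition small_set a : {set 'I_s} := [set l | [exists h, a l < a h]]%SET.

Lemma small_set_mono2 m (i j : 'I_s) x y : i < j -> (x, y) \in small_pairs m ->
  small_set (mono2 m (i, j) (x, y)) = [set i; j]%SET.
Proof.
move=> ij xyS; have [_ aib ajb _ aE] := mintype_mono2 ij xyS.
move: xyS; rewrite mem_small_pairs => xyS.
have [h /andP[hi hj]] := exists_other i j.
apply/setP => l; rewrite !inE; apply/existsP/idP => [[h' lt_lh']|lij].
  apply: contraTT lt_lh'; rewrite negb_or -leqNgt => /andP[li lj].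
  rewrite (aE l li lj); have [->//|h'i] := eqVneq h' i; have [->//|h'j] := eqVneq h' j.
  by rewrite aE.
exists h; rewrite (aE h hi hj); rewrite mono2E /=.
by case/orP: lij => /eqP->; rewrite eqxx; [lia|case: eqP => _; lia].
Qed.

Lemma small_set_mono1 m i b : m %/ 3 < b -> b <= m %/ 2 ->
  small_set (mono1 m i b) = [set i]%SET.
Proof.
move=> h1 h2; have [h /andP[hi _]] := exists_other i i.
apply/setP => l; rewrite !inE; apply/existsP/eqP => [[h']|->].
  by rewrite !mono1E; case: eqP => //; case: eqP => _ _; lia.
by exists h; rewrite !mono1E eqxx (negbTE hi); lia.
Qed.

Lemma small_set_const c : small_set [multinom c | l < s] = (@finset.set0 _).
Proof.
by apply/setP => l; rewrite !inE; apply/existsP => -[h]; rewrite !mnmE ltnn.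
Qed.

Lemma uniq_mintypes Q m : uniq Q -> {subset Q <= small_pairs m} -> uniq (mintypes Q m).
Proof.
move=> uQ QS; rewrite /mintypes !cat_uniq.
have s2 a : a \in [seq mono2 m p q | p <- index_pairs, q <- Q] -> #|small_set a| = 2.
  case/allpairsP=> -[[i j] [x y]] /= []; rewrite mem_index_pairs => ij /QS xy ->.
  by rewrite small_set_mono2 // cards2; case: eqP ij => // ->; rewrite ltnn.
have s1 a : a \in [seq mono1 m i b | i <- enum 'I_s, b <- iota (m %/ 3).+1 (m %/ 2 - m %/ 3)] ->
    #|small_set a| = 1.
  case/allpairsP=> -[i b] /= []; rewrite mem_iota => _ b_in ->.
  by rewrite small_set_mono1 ?cards1 //; lia.
have s0 a : a \in (if 3 %| m then [:: [multinom m %/ 3 | l < s]] else [::]) ->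
    #|small_set a| = 0.
  by case: ifP => // _; rewrite inE => /eqP->; rewrite small_set_const cards0.
apply/and5P; split.
- apply: allpairs_uniq => //; first by rewrite filter_uniq // enum_uniq.
  move=> [[i j] [x y]] [[i' j'] [x' y']] /allpairsP[[p q] /= [pP qQ [? ?]]]; subst p q.
  move=> /allpairsP[[p q] /= [p'P q'Q [? ?]]]; subst p q => /= E.
  rewrite !mem_index_pairs in pP p'P; have xyS := QS _ qQ; have x'y'S := QS _ q'Q.
  have := small_set_mono2 pP xyS; rewrite E (small_set_mono2 p'P x'y'S) => defS.
  have mem_val (h i1 j1 : 'I_s) : h \in [set i1; j1]%SET -> h = i1 :> nat \/ h = j1 :> nat.
    by rewrite !inE => /orP[/eqP->|/eqP->]; [left|right].
  have [ii' jj'] : i = i' :> nat /\ j = j' :> nat.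
    have h1 : i = i' :> nat \/ i = j' :> nat by apply: mem_val; rewrite defS set21.
    have h2 : j = i' :> nat \/ j = j' :> nat by apply: mem_val; rewrite defS set22.
    have h3 : i' = i :> nat \/ i' = j :> nat by apply: mem_val; rewrite -defS set21.
    lia.
  move/val_inj: ii' => ii'; move/val_inj: jj' => jj'; subst i' j'.
  have ji : j != i by apply: contraTneq pP => ->; rewrite ltnn.
  have := congr1 (fun a : 'X_{1..s} => a i) E; have := congr1 (fun a : 'X_{1..s} => a j) E.
  by rewrite !mono2E /= !eqxx (negbTE ji) => -> ->.
- apply/hasPn => a; rewrite mem_cat => a10; apply/negP => /s2 a2.
  by case/orP: a10 => [/s1|/s0]; rewrite a2.
- apply: allpairs_uniq; rewrite ?enum_uniq ?iota_uniq //.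
  move=> [i b] [i' b'] /allpairsP[[p q] /= [_ qI [? ?]]]; subst p q.
  move=> /allpairsP[[p q] /= [_ q'I [? ?]]]; subst p q => /= E.
  move: qI q'I; rewrite !mem_iota => qI q'I.
  have si : small_set (mono1 m i b) = [set i]%SET by apply: small_set_mono1; lia.
  have si' : small_set (mono1 m i' b') = [set i']%SET by apply: small_set_mono1; lia.
  have ii' : i = i' by apply/set1P; rewrite -si' -E si set11.
  subst i'; have [h /andP[hi _]] := exists_other i i.
  have := congr1 (fun a : 'X_{1..s} => a h) E.
  by rewrite !mono1E (negbTE hi) => ->.
- apply/hasPn => a a0; apply/negP => /s1 a1.
  by move: (s0 a a0); rewrite a1.
- by case: ifP.
Qed.

Lemma size_index_pairs : size index_pairs = 'C(s, 2).
Proof.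
rewrite /index_pairs size_filter -sum1_count big_enum_cond /=.
rewrite -(pair_big_dep xpredT (fun i j : 'I_s => i < j) (fun _ _ => 1)) /=.
rewrite (exchange_big_dep xpredT) //= -bin2_sum big_mkord; apply: eq_bigr => j _.
by rewrite (big_ord_narrow (ltnW (ltn_ord j))) sum1_card card_ord.
Qed.

Lemma size_mintypes Q m : size (mintypes Q m) =
  'C(s, 2) * size Q + s * (m %/ 2 - m %/ 3) + (3 %| m).
Proof.
rewrite /mintypes !size_cat !size_allpairs size_index_pairs size_enum_ord size_iota.
by rewrite addnA; case: ifP.
Qed.

End Counting.

End Count.

(** * Star configurations of hypersurfaces *)

Section StarConfiguration.
Variables (k : fieldType) (n s : nat) (F : 'I_s -> {mpoly k[n.+1]}).
Implicit Types (a : 'X_{1..s}) (T : {set 'I_s}).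

Lemma star_monomial (i j : 'I_s) (a1 a2 a3 : nat) : i != j ->
  Gall F ^+ a1 * Gdel1 F i ^+ a2 * Gdel2 F i j ^+ a3 =
  mmap1 F [multinom (a1 + (if l == i then 0 else a2) +
                     (if (l == i) || (l == j) then 0 else a3))%N | l < s].
Proof.
move=> ij; rewrite /Gall /Gdel1 /Gdel2 /mmap1 -!prodrXl.
rewrite [X in _ * X * _]big_mkcond [X in _ * _ * X]big_mkcond -!big_split /=.
apply: eq_bigr => l _; rewrite mnmE !exprD -negb_or.
by case: (l == i); case: (l == j); rewrite ?expr0 ?mulr1.
Qed.

Lemma star_monomial_mintype m (i j : 'I_s) (a1 a2 a3 : nat) a : i != j ->
  (3 * a1 + 2 * a2 + a3)%N = m ->
  a = [multinom (a1 + (if l == i then 0 else a2) +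
                     (if (l == i) || (l == j) then 0 else a3))%N | l < s] ->
  mintype_at m a i j (a1 + a2 + a3).
Proof.
move=> ij defm ->; split=> //; rewrite ?mnmE ?eqxx ?(eq_sym j i) ?(negbTE ij) ?orbT /=;
  [lia..|].
by move=> l /negbTE li /negbTE lj; rewrite mnmE li lj.
Qed.

Lemma mintype_star_monomial m a : mintype m a -> exists (i j : 'I_s) (a1 a2 a3 : nat),
  [/\ i != j, (3 * a1 + 2 * a2 + a3)%N = m &
      a = [multinom (a1 + (if l == i then 0 else a2) +
                     (if (l == i) || (l == j) then 0 else a3))%N | l < s]].
Proof.
case=> i [j [b]]; wlog aij : i j / (a i <= a j)%N => [wlog_ij|].
  have [/wlog_ij//|/ltnW/wlog_ij{}wlog_ij [ij aib ajb defm aE]] := leqP (a i) (a j).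
  apply: wlog_ij; split=> //; [by rewrite eq_sym|lia|by move=> l lj li; exact: aE].
case=> ij aib ajb defm aE; exists i, j, (a i), (a j - a i)%N, (b - a j)%N.
split=> //; first lia; apply/mnmP => l; rewrite mnmE.
have [->|li] := eqVneq l i; first by rewrite /= !addn0.
have [->|lj] := eqVneq l j; first by rewrite /=; lia.
by rewrite aE //=; lia.
Qed.

Lemma star_gensE m : star_gens F m = [set f | exists2 a, mintype m a & f = mmap1 F a].
Proof.
apply/seteqP; split=> [_ [i [j [a1 [a2 [a3 [ij defm ->]]]]]]|_ [a mina ->]] /=.
  rewrite star_monomial //; eexists; last by [].
  by exists i, j, (a1 + a2 + a3)%N; exact: star_monomial_mintype.
have [i [j [a1 [a2 [a3 [ij defm ->]]]]]] := mintype_star_monomial mina.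
by exists i, j, a1, a2, a3; rewrite star_monomial.
Qed.

Lemma star_gens'E m : (2 < s)%N -> star_gens' F m =
  [set f | exists2 a, mintype m a /\ (forall l, (a l < m)%N) & f = mmap1 F a].
Proof.
move=> s3; apply/seteqP; split=> [_ [i [j [a1 [a2 [a3 [ij defm a12 ->]]]]]]|_ [a [mina am] ->]] /=.
  rewrite star_monomial //; eexists; last by [].
  split; first by exists i, j, (a1 + a2 + a3)%N; exact: star_monomial_mintype.
  by move=> l; rewrite mnmE; case: (l == i); case: (l == j) => /=; lia.
have [i [j [a1 [a2 [a3 [ij defm defa]]]]]] := mintype_star_monomial mina.
exists i, j, a1, a2, a3; rewrite star_monomial // -defa; split=> //.
have [h /andP[hi hj]] := exists_other s3 i j.
by have := am h; rewrite defa mnmE (negbTE hi) (negbTE hj) /=; lia.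
Qed.

Hypothesis s4 : (3 < s)%N.
Hypothesis formF : forall i : 'I_s, is_form (F i).
Hypothesis reg4 : forall t : seq 'I_s, uniq t -> size t = 4%N ->
     regular_sequence [seq F i | i <- t].

(** Makes the hypothesis on sequences of four elements available for shorter
    sequences as well. *)
Lemma extend4 T l : (#|T| <= 3)%N -> l \notin T ->
  exists r, uniq (enum T ++ l :: r) /\ size (enum T ++ l :: r) = 4%N.
Proof.
move=> T3 lT; pose C := (~: (l |: T))%SET; exists (take (3 - #|T|) (enum C)).
have cC : (#|C| + #|T|.+1 = s)%N.
  by have := cardsC (l |: T)%SET; rewrite cardsU1 lT card_ord -/C; lia.
split; last first.
  rewrite size_cat /= size_take -!cardE; move: #|C| #|T| T3 cC => c t t3 cs.
  by case: ltnP; lia.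
rewrite cat_uniq enum_uniq /= take_uniq ?enum_uniq // mem_enum (negbTE lT) andbT /=.
have inC h : h \in take (3 - #|T|) (enum C) -> h != l /\ h \notin T.
  by move=> /mem_take; rewrite mem_enum !inE negb_or => /andP[].
rewrite -all_predC; apply/andP; split.
  by apply/allP => h /inC[_ hT] /=; rewrite mem_enum.
by apply/negP => /inC[]; rewrite eqxx.
Qed.

Lemma star_nzd T l : (#|T| <= 3)%N -> l \notin T -> nzd_mod (Jid F T) (F l).
Proof.
move=> T3 lT y; have [r [ur sr]] := extend4 T3 lT.
have [nzd _] := reg4 ur sr.
have {nzd} := nzd #|T| _ y; rewrite size_map sr => /(_ T3).
have -> : [seq F i | i <- enum T ++ l :: r]`_#|T| = F l.
  by rewrite map_cat nth_cat size_map -cardE ltnn subnn.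
have -> : take #|T| [seq F i | i <- enum T ++ l :: r] = [seq F i | i <- enum T].
  by rewrite map_cat cardE -(size_map F) take_size_cat.
have -> : ideal_of [set x | x \in [seq F i | i <- enum T]] = Jid F T; last by apply.
congr ideal_of; apply/seteqP; split=> [x /mapP[i]|_ [i iT ->]] /=.
  by rewrite mem_enum => iT ->; exists i.
by apply: map_f; rewrite mem_enum.
Qed.

Definition eval0 : {rmorphism {mpoly k[n.+1]} -> k} := meval (fun=> 0).

(** A form of degree 0 in a regular sequence vanishes at the origin as well: it
    cannot be a unit. *)
Lemma star_eval0 l : eval0 (F l) = 0.
Proof.
have [d /dhomogP homF] := formF l.
have mmap1_0 (b : 'X_{1..n.+1}) : b != 0%MM -> mmap1 (fun=> 0 : k) b = 0.
  rewrite -mdeg_eq0 -lt0n mdegE lt0n sum_nat_eq0 negb_forall => /existsP[i bi].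
  by rewrite (mmap1_split _ (l := i)) ?mul0r // lt0n.
case: d homF => [|d] homF; last first.
  rewrite /= meval_sum_supp big_seq big1 // => b /homF db.
  by rewrite mmap1_0 ?mulr0 // -mdeg_eq0 db.
have F_C : F l = ((F l)@_0)%:MP.
  apply/mpolyP => b; rewrite mcoeffC; case: eqP => [->|b0]; rewrite ?mulr1 //.
  by rewrite mulr0; apply: (mcoeff_eq0P homF) => /eqP; rewrite mdeg_eq0 => /eqP.
rewrite F_C /= mevalC; apply: contrapT => /eqP c0.
have [||r [ur sr]] := @extend4 (@finset.set0 _) l; rewrite ?cards0 ?inE //.
have [_ []] := reg4 ur sr.
have -> : 1 = ((F l)@_0)^-1%:MP * F l :> {mpoly k[n.+1]}.
  by rewrite [X in _ * X]F_C -mpolyCM mulVf.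
have [_ _] := ideal_of_is_ideal [set x | x \in [seq F i | i <- enum (@finset.set0 'I_s) ++ l :: r]].
apply; apply: ideal_of_gen => /=.
by apply: map_f; rewrite mem_cat inE eqxx orbT.
Qed.

Lemma star_ideal3E : star_ideal3 F = star3 F.
Proof.
have JE i j h : ideal_of [set F i; F j; F h] = Jid F (i |: [set j; h])%SET.
  congr ideal_of; apply/seteqP; split=> [x [[->|->]|->]|_ [l + ->]] /=.
  - by exists i; rewrite ?inE ?eqxx.
  - by exists j; rewrite ?inE ?eqxx ?orbT.
  - by exists h; rewrite ?inE ?eqxx ?orbT.
  - by rewrite !inE => /or3P[/eqP->|/eqP->|/eqP->]; [left; left|left; right|right].
apply/seteqP; split=> [f fI T T3|f fI i j h ij jh]; last first.
  rewrite JE; apply: fI; rewrite cardsU1 cards2 !inE.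
  have ne (x y : 'I_s) : (x < y)%N -> x != y.
    by move=> xy; apply: contraTneq xy => ->; rewrite ltnn.
  by rewrite negb_or (ne _ _ ij) (ne _ _ jh) (ne _ _ (ltn_trans ij jh)).
have srt : sorted (fun x y : 'I_s => (x < y)%N) (enum T).
  rewrite /enum_mem; apply: sorted_filter; first by move=> x y z; exact: ltn_trans.
  by have := iota_ltn_sorted 0 s; rewrite -val_enum_ord sorted_map enumT.
have : size (enum T) = 3%N by rewrite -cardE.
case defT: (enum T) srt => [|i [|j [|h []]]] //= /and3P[ij jh _] _.
have -> : T = (i |: [set j; h])%SET.
  by apply/setP => x; rewrite -mem_enum defT !inE.
by rewrite -JE; exact: fI.
Qed.

End StarConfiguration.

Lemma count_mu_formula s m q r : m = (6 * q + r)%N -> (r <= 5)%N ->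
  ('C(s, 2) * size (small_pairs m) + s * (m %/ 2 - m %/ 3) + (3 %| m))%N%:R
    = mu_formula s m r.
Proof.
move=> ->; rewrite size_small_pairs6; set C := 'C(s, 2).
have c1E : ((6 * q + r) %/ 2 - (6 * q + r) %/ 3 = q + (r %/ 2 - r %/ 3))%N by lia.
have m3E : ((3 %| 6 * q + r) = (3 %| r))%N by lia.
rewrite c1E m3E.
clear c1E m3E.
have small_values : (r <= 5)%N -> [/\ size (small_pairs r) = nth 0%N [:: 0; 1; 1; 3; 4; 6]%N r,
    (r %/ 2 - r %/ 3 = nth 0%N [:: 0; 0; 1; 0; 1; 1]%N r)%N &
    (3 %| r)%N = nth false [:: true; false; false; true] r].
  by case: r => [|[|[|[|[|[|r]]]]]].
move=> r5; have [-> -> ->] := small_values r5.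
case: r r5 {small_values} => [|[|[|[|[|[|r]]]]]] // _; rewrite /mu_formula -/C /=.
all: rewrite !(natrD, natrM).
all: field; done.
Qed.

Lemma sdefect_formulaE s m r : (r <= 5)%N ->
  sdefect_formula s m r = mu_formula s m r - 'C(s, 2)%:R.
Proof. by case: r => [|[|[|[|[|[|r]]]]]] // _; rewrite /sdefect_formula /mu_formula; ring. Qed.

Theorem corollary4p17 (k : fieldType) (n s : nat)
    (F : 'I_s -> {mpoly k[n.+1]}) (m q r : nat) :
  (3 < s)%N ->
  (forall i : 'I_s, is_form (F i)) ->
  (forall t : seq 'I_s, uniq t -> size t = 4%N ->
     regular_sequence [seq F i | i <- t]) ->
  (0 < m)%N ->
  m = (6 * q + r)%N ->
  (r <= 5)%N ->
  (minimal_generating_set (symbolic_power (star_ideal3 F) m) [set 0]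
       (star_gens F m) /\
   exists N : nat,
     mu_is (symbolic_power (star_ideal3 F) m) [set 0] N /\
     N%:R = mu_formula s m r) /\
  (minimal_generating_set (symbolic_power (star_ideal3 F) m)
       (ideal_pow (star_ideal3 F) m) (star_gens' F m) /\
   exists N : nat,
     sdefect_is (star_ideal3 F) m N /\ N%:R = sdefect_formula s m r).
Proof.
move=> s4 formF reg4 m0 defm r5.
have s3 := ltnW s4.
have nzdF := star_nzd s4 reg4.
have eF := star_eval0 s4 formF reg4.
rewrite /sdefect_is (star_ideal3E F) (star_gensE F) (star_gens'E F m s3).
have uS := uniq_small_pairs m.
have [min1 mu1] := star_minimal (@noetherian k n.+1) s4 nzdF eF
  (uniq_mintypes s3 uS (fun q => id)) (mem_mintypes s3 m).
have [min2 mu2] := star_minimal_mod_pow (@noetherian k n.+1) s4 nzdF eF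
  (uniq_mintypes s3 (filter_uniq _ uS) (mem_subseq (filter_subseq _ _)))
  (fun a => mem_mintypes_lt s3 a m0).
split; split=> //.
  eexists; split; first exact: mu1.
  by rewrite size_mintypes; exact: count_mu_formula defm r5.
eexists; split; first exact: mu2.
rewrite sdefect_formulaE // -(count_mu_formula s defm r5) size_mintypes.
have -> : size (small_pairs m) = (size [seq p <- small_pairs m | p != (0%N, 0%N)]).+1.
  have S00 : (0%N, 0%N) \in small_pairs m by rewrite mem_small_pairs m0.
  by rewrite (perm_size (perm_to_rem S00)) /= rem_filter.
by rewrite mulnS -!addnA [in RHS]natrD [RHS]addrAC subrr add0r.
Qed.
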